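(* Let $X$ be a random vector in $\mathbb{R}^d$, $d \ge 1$. If $K_X$ has the projection property, then $\mathcal{D}(I_X) \subset C_X$ and $$\mathcal{D}(I_X) = \operatorname{rint} C_X \cup \bigcup_{C_1 \in \mathcal{F}^*_+(C_X)} \biggl( \operatorname{rint} C_{X|C_1} \cup \bigcup_{C_2 \in \mathcal{F}^*_+(C_{X|C_1})} \Bigl( \operatorname{rint} C_{X|C_2} \cup \ldots \cup \bigcup_{C_d \in \mathcal{F}^*_+(C_{X|C_{d-1}})} \operatorname{rint} C_{X|C_d} \Bigr) \biggr).$$ That is, $\mathcal{D}(I_X)$ is the union of $\operatorname{rint} C_X$ and of all the sets $\operatorname{rint} C_{X|C_k}$, over all $1 \le k \le d$ and all chains $C_1, \ldots, C_k$ with $C_1 \in \mathcal{F}^*_+(C_X)$ and $C_{i+1} \in \mathcal{F}^*_+(C_{X|C_i})$ for $1 \le i < k$.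
   Context: For a random vector $Y$ in $\mathbb{R}^d$: $K_Y(u) := \log \mathbb{E} e^{u \cdot Y} \in (-\infty, +\infty]$ for $u \in \mathbb{R}^d$; the rate function is $I_Y(v) := \sup_{u \in \mathbb{R}^d} (u \cdot v - K_Y(u)) \in [0, +\infty]$. For $f:\mathbb{R}^d \to (-\infty, +\infty]$, $\mathcal{D}(f) := \{u : f(u) < +\infty\}$. $\operatorname{rint} A$ is the interior of $A$ in the relative topology of its affine hull (so $\operatorname{rint} A = A$ for a single point). $\operatorname{supp} Y$ is the smallest closed set $S$ with $\mathbb{P}(Y \in S) = 1$, and $C_Y := \operatorname{conv}(\operatorname{supp} Y)$ (not necessarily closed). Hyperplanes are affine; a hyperplane $L$ supports a convex set $C$ if $L \cap C \neq \varnothing$ and $C$ is contained in one of the two closed half-spaces bounded by $L$ ($C \subset L$ is allowed). $\mathrm{Pr}_L$ is the orthogonal projection of $\mathbb{R}^d$ onto $L$. For a Borel set $A$ with $\mathbb{P}(Y \in A) > 0$, $Y|A$ is a random vector distributed as $Y$ conditioned on $\{Y \in A\}$. Faces: a face of a non-empty convex set $C \subset \mathbb{R}^d$ is a convex subset $C'$ of $C$ such that every closed line segment in $C$ with a relative interior point in $C'$ has both endpoints in $C'$ ($C$ itself is a face). $\mathcal{F}(C)$ is the set of non-empty faces of $C$, and $\mathcal{F}^*(C)$ is the set of maximal proper faces: those $C' \in \mathcal{F}(C) \setminus \{C\}$ such that $C' \not\subset C''$ for every $C'' \in \mathcal{F}(C) \setminus \{C, C'\}$. Put $\mathcal{F}^*_+(C_Y)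 := \{C \in \mathcal{F}^*(C_Y) : \mathbb{P}(Y \in C) > 0\}$ (every $C \in \mathcal{F}^*(C_Y)$ is Borel); thus $\mathcal{F}^*_+(C_{X|C_1})$ is defined with $Y = X|C_1$, etc. For $C_2 \in \mathcal{F}^*_+(C_{X|C_1})$, the vector $(X|C_1)|C_2$ has the same distribution as $X|C_2$. Projection property (defined by recursion in $\dim C_X$, using $\dim C_{X|C} < \dim C_X$ for $C \in \mathcal{F}^*_+(C_X)$): $K_X$ has the projection property if (i) for every hyperplane $L$ in $\mathbb{R}^d$ supporting $C_X$ with $0 < \mathbb{P}(X \in L) < 1$, $\mathrm{Pr}_L(\operatorname{rint} \mathcal{D}(K_X)) = \mathrm{Pr}_L(\operatorname{rint} \mathcal{D}(K_{X|L}))$; and (ii) $K_{X|C}$ has the projection property for every $C \in \mathcal{F}^*_+(C_X)$. (This is a property of the distribution of $X$. Both conditions hold vacuously when $\mathcal{F}^*_+(C_X) = \varnothing$, in particular when $X$ is a.s. constant.) *)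

(* Defs.v *)
From HB Require Import structures.
From mathcomp Require Import all_boot all_order all_algebra.
From mathcomp Require Import all_classical all_reals all_analysis.

Set Implicit Arguments.
Unset Strict Implicit.
Unset Printing Implicit Defensive.

Import Order.TTheory GRing.Theory Num.Theory.
Import numFieldNormedType.Exports.

Local Open Scope classical_set_scope.
Local Open Scope ring_scope.

Section convex_geometry.
Context {R : realType} {d : nat}.
Implicit Types (x y a u v : 'rV[R]_d) (A C F L : set 'rV[R]_d).

Definition dot u v : R := \sum_(i < d) u 0 i * v 0 i.

Definition affine_set A : Prop :=
  forall x y (t : R), A x -> A y -> A ((1 - t) *: x + t *: y).

Definition affine_hull A : set 'rV[R]_d := smallest affine_set A.

Definition convex_hull A : set 'rV[R]_d :=
  smallest (fun C => convex_set (C : set (convex_lmodType 'rV[R]_d))) A.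

Definition rint A : set 'rV[R]_d :=
  [set x | affine_hull A x /\ \forall y \near x, affine_hull A y -> A y].

(* To be used with [C] convex: the closed segments contained in [C] are then
   those with both endpoints in [C]. The relative interior of a segment with
   distinct endpoints consists of its points with parameter 0 < t < 1. *)
Definition face C F : Prop :=
  [/\ F `<=` C,
      convex_set (F : set (convex_lmodType 'rV[R]_d)) &
      forall x y (t : R), C x -> C y -> 0 < t -> t < 1 ->
        F ((1 - t) *: x + t *: y) -> F x /\ F y].

Definition nonempty_faces C : set (set 'rV[R]_d) :=
  [set F | face C F /\ F !=set0].

Definition maximal_proper_faces C : set (set 'rV[R]_d) :=
  [set F | [/\ nonempty_faces C F, F <> C &
    forall F', nonempty_faces C F' -> F' <> C -> F' <> F -> ~ (F `<=` F')]].

(* A hyperplane is given by a normal vector [a], required to be non-zero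
   wherever this is used, and an offset [b]. *)
Definition hyperplane a (b : R) : set 'rV[R]_d := [set x | dot a x = b].

Definition supports a (b : R) C : Prop :=
  hyperplane a b `&` C !=set0 /\
  (C `<=` [set x | dot a x <= b] \/ C `<=` [set x | b <= dot a x]).

(* For [a != 0], the orthogonal projection onto [hyperplane a b]. *)
Definition hyperplane_proj a (b : R) x : 'rV[R]_d :=
  x + ((b - dot a x) / dot a a) *: a.

Definition effective_domain (f : 'rV[R]_d -> \bar R) : set 'rV[R]_d :=
  [set u | (f u < +oo)%E].

End convex_geometry.

(* The Borel sigma-algebra of R^d. *)
Notation borel_rV R d := (g_sigma_algebraType (@open 'rV[R]_d)).

Section conditioning.
Context {disp : measure_display} {T : measurableType disp} {R : realType}.

(* [P] conditioned on the event [B]; see [cond_probE]. The value is the junk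
   [P] when [B] is not measurable or has probability 0. *)
Definition cond_prob (P : probability T R) (B : set T) : probability T R :=
  match pselect (measurable B) with
  | left mB => mnormalize (mrestr P mB) P
  | right _ => P
  end.

Lemma cond_probE (P : probability T R) (B A : set T) :
  measurable B -> (0 < P B)%E ->
  cond_prob P B A = (P (A `&` B) * ((fine (P B))^-1)%:E)%E.
Proof.
move=> mB PB; rewrite /cond_prob; case: pselect => // mB'.
rewrite /= /mnormalize /= /mrestr setTI gt_eqF//=.
by rewrite lt_eqF// (le_lt_trans (probability_le1 P mB)) ?ltey.
Qed.

End conditioning.

(* The law of a random vector Y in R^d is represented by a pair ([P], [X]),
   with Y being [X] under [P]. The random vector Y|A is then represented by
   [X] under [cond_prob P (X @^-1` A)]. *)
Section random_vectors.
Context {disp : measure_display} {T : measurableType disp} {R : realType}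
  {d : nat}.
Implicit Types (P : probability T R) (X : T -> 'rV[R]_d) (A : set 'rV[R]_d).

Definition given P X A : probability T R := cond_prob P (X @^-1` A).

Definition cumulant P X (u : 'rV[R]_d) : \bar R :=
  lne 'E_P[fun t => expR (dot u (X t))].

Definition rate_function P X (v : 'rV[R]_d) : \bar R :=
  ereal_sup (range (fun u => (dot u v)%:E - cumulant P X u)%E).

Definition supp P X : set 'rV[R]_d :=
  \bigcap_(S in [set S | closed S /\ P (X @^-1` S) = 1%E]) S.

Definition convsupp P X : set 'rV[R]_d := convex_hull (supp P X).

Definition charged_maximal_faces P X : set (set 'rV[R]_d) :=
  [set C | maximal_proper_faces (convsupp P X) C /\ (0 < P (X @^-1` C))%E].

(* The recursion terminates because the dimension of the convex hull of the
   support drops from [P] to [given P X C]; hence the least fixed point given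
   by an inductive predicate is the only solution of the recursion. *)
Inductive projection_property X P : Prop :=
| ProjectionProperty of
    (forall (a : 'rV[R]_d) (b : R), a != 0 ->
       supports a b (convsupp P X) ->
       (0 < P (X @^-1` hyperplane a b) < 1)%E ->
       hyperplane_proj a b @` rint (effective_domain (cumulant P X)) =
       hyperplane_proj a b @`
         rint (effective_domain (cumulant (given P X (hyperplane a b)) X))) &
    (forall C, charged_maximal_faces P X C ->
       projection_property X (given P X C)).

End random_vectors.

(* Main.v *)
(* Write D for the set of points v of finite rate. It is characterised by a
   bound c exp (u . v) <= E exp (u . X), uniform in u, for some c > 0.

   Interior. D is convex, and it contains the conditional mean of X on every
   bounded event of positive probability, so supp X lies in its closure. If v in
   rint C_X were not in D, a proper separation of v from D would confine X to
   a hyperplane through v, hence also D, contradicting properness.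

   Boundary. If v in D is not in rint C_X, separate v properly from C_X by
   a . x <= b = a . v. Applying the bound at u + n a and letting n tend to
   infinity gives c exp (u . v) <= E [exp (u . X); a . X = b] whenever
   K_X (u) is finite. Taking u = 0, the hyperplane L has positive probability;
   the projection property extends the bound to all u in rint D(K_{X|L}), and
   convexity to all u, so v has finite rate for X|L. The face C_X /\ L lies in
   a maximal proper face C_1, which is exposed by a hyperplane L_1; X|L lives
   on L_1, hence so does v, and the same argument with L_1 gives that v has
   finite rate for X|C_1, whose support has smaller dimension.

   Conversely, E exp (u . X) >= P (X in C) E exp (u . X|C) makes every point of
   finite rate for X|C a point of finite rate for X. *)

Require Import Defs.
From HB Require Import structures.
From mathcomp Require Import all_boot all_order all_algebra.
From mathcomp Require Import all_classical all_reals all_analysis.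
From mathcomp Require Import ring lra measurable_realfun.

Set Implicit Arguments.
Unset Strict Implicit.
Unset Printing Implicit Defensive.

Import Order.TTheory GRing.Theory Num.Theory.
Import numFieldNormedType.Exports.

Local Open Scope classical_set_scope.
Local Open Scope ring_scope.

(** * Convex sets and relative interiors *)

Section dot.
Context {R : realType} {d : nat}.
Implicit Types (x y a u v : 'rV[R]_d).

Lemma dotC u v : dot u v = dot v u.
Proof. by apply: eq_bigr => i _; rewrite mulrC. Qed.

Lemma dotDr a u v : dot a (u + v) = dot a u + dot a v.
Proof.
by rewrite /dot -big_split; apply: eq_bigr => i _; rewrite mxE mulrDr.
Qed.

Lemma dotZr a (t : R) u : dot a (t *: u) = t * dot a u.
Proof.
by rewrite /dot mulr_sumr; apply: eq_bigr => i _; rewrite mxE mulrCA.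
Qed.

Lemma dotNr a u : dot a (- u) = - dot a u.
Proof. by rewrite -scaleN1r dotZr mulN1r. Qed.

Lemma dotBr a u v : dot a (u - v) = dot a u - dot a v.
Proof. by rewrite dotDr dotNr. Qed.

Lemma dotDl u v a : dot (u + v) a = dot u a + dot v a.
Proof. by rewrite dotC dotDr !(dotC a). Qed.

Lemma dotZl (t : R) u a : dot (t *: u) a = t * dot u a.
Proof. by rewrite dotC dotZr dotC. Qed.

Lemma dot0l a : dot 0 a = 0.
Proof. by rewrite -(scale0r 0) dotZl mul0r. Qed.

Lemma dot_gt0 a : a != 0 -> 0 < dot a a.
Proof.
move=> a0; rewrite lt_neqAle sumr_ge0 ?andbT; last first.
  by move=> i _; exact: sqr_ge0.
apply: contra a0 => /eqP/esym/psumr_eq0P H; apply/eqP/rowP => i.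
rewrite mxE; apply/eqP; rewrite -sqrf_eq0 expr2 H// => j _.
exact: sqr_ge0.
Qed.

Lemma dot_continuous a : continuous (dot a).
Proof.
apply: (@continuous_big R) => [|i _ x]; first exact: add_continuous.
have h : (fun u : 'rV[R]_d => u 0 i) @ x --> x 0 i by exact: coord_continuous.
exact: (cvgMl_tmp h).
Qed.

Lemma line_continuous x y : continuous (fun t : R => x + t *: y).
Proof.
move=> t; apply: cvgD; first exact: cvg_cst.
by apply: (@cvgZr_tmp _ _ _ _ _ (fun t => t)); exact: cvg_id.
Qed.

Lemma dilation_continuous x z (s : R) :
  continuous (fun y : 'rV[R]_d => x + s *: (y - z)).
Proof.
move=> y; apply: (@cvgD _ _ _ (nbhs (y : 'rV[R]_d)) _ (fun=> x)).
  exact: cvg_cst.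
have h : (fun y : 'rV[R]_d => y - z) @ y --> y - z.
  by apply: (@cvgB _ _ _ (nbhs y)); [exact: cvg_id|exact: cvg_cst].
exact: (cvgZl_tmp h).
Qed.

End dot.

Section convex.
Context {R : realType} {d : nat}.
Implicit Types (x y a u v : 'rV[R]_d) (A C F : set 'rV[R]_d).

Definition convex A :=
  forall x y (t : R), A x -> A y -> 0 <= t -> t <= 1 ->
    A ((1 - t) *: x + t *: y).

Lemma convex_setP A :
  convex_set (A : set (convex_lmodType 'rV[R]_d)) <-> convex A.
Proof.
split=> cA x y.
  move=> t Ax Ay t0 t1; rewrite addrC.
  by have := @cA y x (Itv01 t0 t1); rewrite !inE; apply.
move=> t; rewrite !inE => Ax Ay.
have h := cA _ _ t%:num Ay Ax (ge0 t) (le1 t).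
by rewrite addrC in h; exact: h.
Qed.

Lemma affine_hull_sub A : A `<=` affine_hull A.
Proof. by move=> x Ax B [_]; exact. Qed.

Lemma affine_hull_min A B : affine_set B -> A `<=` B -> affine_hull A `<=` B.
Proof. by move=> affB AB x; apply; split. Qed.

Lemma affine_hull_affine A : affine_set (affine_hull A).
Proof.
move=> x y t Ax Ay B hB; case: (hB) => affB _.
by apply: affB; [exact: Ax|exact: Ay].
Qed.

(** [affine_set] only provides two-point combinations; the translate is the midpoint of
    [(1 - 2s) x + 2s y] and [(1 + 2s) x - 2s z]. *)
Lemma affine_hull_translate A x y z (s : R) :
  affine_hull A x -> affine_hull A y -> affine_hull A z ->
  affine_hull A (x + s *: (y - z)).
Proof.
move=> Ax Ay Az; have aff := @affine_hull_affine A.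
have := aff _ _ (1 / 2) (aff _ _ (2 * s) Ax Ay) (aff _ _ (- (2 * s)) Ax Az).
congr (affine_hull A _); apply/rowP => i; rewrite !mxE; by field.
Qed.

Lemma rint_sub A : rint A `<=` A.
Proof. by move=> x [hx /nbhs_singleton]; exact. Qed.

Lemma rint_prolong A x e : rint A e -> affine_hull A x ->
  exists y (t : R), [/\ A y, 0 < t, t < 1 & e = (1 - t) *: x + t *: y].
Proof.
move=> [he ne] Ax.
have : \forall s \near (0 : R), affine_hull A (e + s *: (e - x)) ->
    A (e + s *: (e - x)).
  have := @line_continuous R d e (e - x) 0.
  by rewrite /continuous_at scale0r addr0 => /(_ _ ne).
move=> /nbhs_ballP[r /= r0 H].
(* Go past [e], away from [x], by half the radius of the neighbourhood of parameters; the value of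
   [t] is then forced. *)
exists (e + (r / 2) *: (e - x)), (1 + r / 2)^-1.
have r2 : 0 < r / 2 by rewrite divr_gt0.
split.
- apply: H; last exact: affine_hull_translate.
  by rewrite /ball /= sub0r normrN gtr0_norm// ltr_pdivrMr// ltr_pMr// ltr1n.
- by rewrite invr_gt0; lra.
- by rewrite invf_lt1; lra.
- by apply/rowP => i; rewrite !mxE; field; lra.
Qed.

(** The dilation of ratio [1 / t] taking [z] to [u0] sends points of the affine hull near [z] to
    points of [A] near [u0], and each such point is a convex combination of [u] and its image. *)
Lemma rint_segment A u u0 (t : R) : convex A -> A u -> rint A u0 ->
  0 < t -> t <= 1 -> rint A ((1 - t) *: u + t *: u0).
Proof.
move=> cA Au [hu0 nu0] t0 t1; set z := (1 - t) *: u + t *: u0.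
have hz : affine_hull A z.
  by apply: affine_hull_affine => //; exact: affine_hull_sub.
split=> //.
have := @dilation_continuous R d u0 z t^-1 z.
rewrite /continuous_at subrr scaler0 addr0 => h0.
have {}h0 : \forall y \near z, affine_hull A (u0 + t^-1 *: (y - z)) ->
  A (u0 + t^-1 *: (y - z)) := h0 _ nu0.
near=> y => hy.
have H : affine_hull A (u0 + t^-1 *: (y - z)) -> A (u0 + t^-1 *: (y - z)).
  by near: y.
have {H} H := H (affine_hull_translate _ hu0 hy hz).
suff -> : y = (1 - t) *: u + t *: (u0 + t^-1 *: (y - z)).
  by apply: cA => //; exact: ltW.
by rewrite scalerDr scalerA divff ?gt_eqF// scale1r addrA -/z addrCA subrr addr0.
Unshelve. all: by end_near.
Qed.

Lemma convex_weighted (I : Type) (s : seq I) (c : I -> R) (w : I -> 'rV[R]_d)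
    A x0 (c0 : R) :
  convex A -> A x0 -> (forall i, A (w i)) -> (forall i, 0 <= c i) -> 0 < c0 ->
  A ((c0 + \sum_(i <- s) c i)^-1 *: (c0 *: x0 + \sum_(i <- s) c i *: w i)).
Proof.
move=> cA Ax0 Aw ci cp; elim: s => [|i s IH].
  by rewrite !big_nil !addr0 scalerA mulVf ?scale1r ?gt_eqF.
rewrite !big_cons; set S := \sum_(j <- s) c j in IH *.
set W := \sum_(j <- s) _ in IH *.
have S0 : 0 <= S by exact: sumr_ge0.
have ci0 := ci i.
have := cA _ _ (c i / (c0 + (c i + S))) IH (Aw i).
have -> : (1 - c i / (c0 + (c i + S))) *:
  ((c0 + S)^-1 *: (c0 *: x0 + W)) + (c i / (c0 + (c i + S))) *: w i =
  (c0 + (c i + S))^-1 *: (c0 *: x0 + (c i *: w i + W)).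
  by apply/rowP => j; rewrite !mxE; field; apply/andP; split; lra.
apply; first by apply: divr_ge0; lra.
by rewrite ler_pdivrMr; lra.
Qed.

End convex.

(** * Dimension *)

Section dimension.
Context {R : realType} {d : nat}.
Implicit Types (x y a u v : 'rV[R]_d) (A B C F : set 'rV[R]_d).

(** A maximal affinely independent family in [A], stored as a base point and a matrix of
    differences; [m] is thus the dimension of the affine hull. *)
Definition frame A x0 m (M : 'M[R]_(m, d)) :=
  [/\ A x0, row_free M, forall i, A (x0 + row i M) &
      forall x, A x -> (x - x0 <= M)%MS].

Definition has_dim A m := exists x0 (M : 'M[R]_(m, d)), frame A x0 M.

(** Fix the base point and take the largest number of independent differences; a point outside their
    span would give one more. *)
Lemma has_dim_exists A : A !=set0 -> exists m, has_dim A m.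
Proof.
move=> [x0 Ax0].
pose Q k := `[< exists M : 'M[R]_(k, d),
  row_free M /\ forall i, A (x0 + row i M) >].
have Q0 : exists k, Q k.
  exists 0%N; apply/asboolP; exists 0; split; last by case.
  by rewrite /row_free mxrank0.
have Qd k : Q k -> (k <= d)%N.
  by move=> /asboolP[M [/eqP rM _]]; have := rank_leq_col M; rewrite rM.
case: (ex_maxnP Q0 Qd) => k /asboolP[M [fM AM]] kmax.
exists k, x0, M; split=> // x Ax; apply: contrapT => /negP nxM.
suff : (k + 1 <= k)%N by rewrite addn1 ltnn.
apply: kmax; apply/asboolP; exists (col_mx M (x - x0)); split.
  suff : (\rank M < \rank (col_mx M (x - x0)))%N.
    by rewrite (eqP fM) /row_free eqn_leq rank_leq_row /= -{1}addn1.
  apply: rank_ltmx; rewrite /ltmx -addsmxE addsmxSl /=.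
  by rewrite col_mx_sub submx_refl.
move=> i; case: (split_ordP i) => j ->.
  by rewrite rowKu.
by rewrite rowKd row_id addrC subrK.
Qed.

Lemma frame_submx A B x0 y0 m n (M : 'M[R]_(m, d)) (N : 'M[R]_(n, d)) :
  frame A x0 M -> frame B y0 N -> A `<=` B -> (M <= N)%MS.
Proof.
move=> [Ax0 _ AM _] [_ _ _ BN] AB; apply/row_subP => i.
have -> : row i M = (x0 + row i M - y0) - (x0 - y0).
  by rewrite opprB addrA subrK addrC addKr.
by rewrite addmx_sub ?eqmx_opp// BN//; exact: AB.
Qed.

Lemma has_dim_le A B m n : has_dim A m -> has_dim B n -> A `<=` B ->
  (m <= n)%N.
Proof.
move=> [x0 [M fA]] [y0 [N fB]] AB.
have := mxrankS (frame_submx fA fB AB).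
by case: fA fB => [_ /eqP -> _ _] [_ /eqP -> _ _].
Qed.

Lemma has_dim_leq A m : has_dim A m -> (m <= d)%N.
Proof. by move=> [x0 [M [_ /eqP rM _ _]]]; have := rank_leq_col M; rewrite rM. Qed.

Lemma affine_hull_frame A x0 m (M : 'M[R]_(m, d)) x : frame A x0 M ->
  affine_hull A x <-> (x - x0 <= M)%MS.
Proof.
move=> [Ax0 _ AM AsM]; split.
  have aff : affine_set [set x | (x - x0 <= M)%MS].
    move=> y z t /= yM zM.
    have -> : (1 - t) *: y + t *: z - x0 =
      (1 - t) *: (y - x0) + t *: (z - x0).
      by apply/rowP => j; rewrite !mxE; ring.
    by rewrite addmx_sub// scalemx_sub.
  by move=> Ax; exact: (affine_hull_min aff _ Ax).
move=> /submxP[c xc]; rewrite -(subrK x0 x) addrC xc mulmx_sum_row.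
elim/big_rec : _ => [|i y _ Ay].
  by rewrite addr0; exact: affine_hull_sub.
have -> : x0 + (c 0 i *: row i M + y) =
    (x0 + y) + c 0 i *: ((x0 + row i M) - x0).
  by apply/rowP => j; rewrite !mxE; ring.
by apply: affine_hull_translate => //; exact: affine_hull_sub.
Qed.

(** Equal ranks turn the inclusion of direction spaces into an equality. *)
Lemma affine_hull_dim A B m : has_dim A m -> has_dim B m -> A `<=` B ->
  B `<=` affine_hull A.
Proof.
move=> [x0 [M fA]] [y0 [N fB]] AB x Bx.
apply/(affine_hull_frame _ fA).
have MN := frame_submx fA fB AB.
have NM : (N <= M)%MS.
  rewrite -(mxrank_leqif_sup MN).
  by case: fA fB => [_ /eqP -> _ _] [_ /eqP -> _ _].
apply: submx_trans NM.
have -> : x - x0 = (x - y0) - (x0 - y0) by rewrite opprB addrA subrK.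
case: fB => _ _ _ BN.
by rewrite addmx_sub ?eqmx_opp// BN//; apply: AB; case: fA.
Qed.

(* The barycentre of the simplex spanned by a frame. *)
Lemma rint_exists A : convex A -> A !=set0 -> exists e, rint A e.
Proof.
move=> cA /has_dim_exists[m [x0 [M fA]]].
have [Ax0 fM AM AsM] := fA.
pose k : 'rV[R]_m := const_mx (m.+1%:R)^-1.
exists (x0 + k *m M); split.
  by apply/(affine_hull_frame _ fA); rewrite addrC addKr submxMl.
pose N := pinvmx M.
(* [c y i] is the [i]-th coordinate of [y - x0] along the rows of [M]; as a difference of dot
   products it is visibly continuous in [y]. *)
pose c y i := dot (col i N)^T y - dot (col i N)^T x0.
have cE y i : c y i = ((y - x0) *m N) 0 i.
  rewrite /c -dotBr dotC /dot mxE; apply: eq_bigr => j _.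
  by rewrite !mxE.
have ckE i : c (x0 + k *m M) i = (m.+1%:R)^-1.
  by rewrite cE addrC addKr -mulmxA mulmxVp// mulmx1 mxE.
have cc i : continuous (c ^~ i).
  move=> y; apply: (@cvgB _ _ _ (nbhs (y : 'rV[R]_d)));
    [exact: dot_continuous|exact: cvg_cst].
have cs : continuous (fun y => \sum_i c y i).
  by apply: (@continuous_big R) => [|i _]; [exact: add_continuous|exact: cc].
have H1 : \forall y \near x0 + k *m M, forall i, 0 < c y i.
  apply: (@filter_forall _ _ _ (nbhs (x0 + k *m M : 'rV[R]_d))) => i.
  apply: (cc i (x0 + k *m M) [set r | 0 < r]).
  by apply: lt_nbhsr; rewrite ckE invr_gt0 ltr0n.
have H2 : \forall y \near x0 + k *m M, \sum_i c y i < 1.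
  apply: (cs (x0 + k *m M) [set r | r < 1]).
  apply: lt_nbhsl; under eq_bigr do rewrite ckE.
  rewrite sumr_const card_ord -[_ *+ _]mulr_natr mulrC ltr_pdivrMr ?ltr0n//.
  by rewrite mul1r ltr_nat.
near=> y => hy.
have H1y : forall i, 0 < c y i by near: y.
have H2y : \sum_i c y i < 1 by near: y.
have yM : (y - x0 <= M)%MS by apply/(affine_hull_frame _ fA).
have E : (1 - \sum_i c y i) *: x0 + \sum_i c y i *: (x0 + row i M) = y.
  have -> : \sum_i c y i *: (x0 + row i M) =
      (\sum_i c y i) *: x0 + \sum_i c y i *: row i M.
    apply/rowP => j; rewrite !mxE !summxE mulr_suml -big_split.
    by apply: eq_bigr => i _; rewrite !mxE mulrDr.
  rewrite addrA -scalerDl subrK scale1r.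
  rewrite -[RHS](subrK x0) addrC; congr (_ + _).
  rewrite -(mulmxKpV yM) mulmx_sum_row.
  by apply: eq_bigr => i _; rewrite cE.
have c0 : 0 < 1 - \sum_i c y i by rewrite subr_gt0.
have := @convex_weighted _ _ _ (index_enum _) (c y) (fun i => x0 + row i M)
  A x0 _ cA Ax0 AM (fun i => ltW (H1y i)) c0.
by rewrite subrK invr1 scale1r E.
Unshelve. all: by end_near.
Qed.

End dimension.

(** * Faces *)

Section faces.
Context {R : realType} {d : nat}.
Implicit Types (x y a u v : 'rV[R]_d) (A B C F : set 'rV[R]_d).

Lemma face_convex C F : face C F -> convex F.
Proof. by case=> _ /convex_setP. Qed.

(** The segment from [x] to a relative interior point [e] of [F] can be prolonged beyond [e] inside
    [F]; extremality at [e] then puts [x] in [F]. *)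
Lemma face_affine_hull C F : face C F -> F !=set0 ->
  C `&` affine_hull F `<=` F.
Proof.
move=> fF F0 x [Cx Fx]; have [e Fe] := rint_exists (face_convex fF) F0.
have [y [t [Fy t0 t1 eE]]] := rint_prolong Fe Fx.
have [FC _ ext] := fF.
have Fe' := rint_sub Fe; rewrite eE in Fe'.
by case: (ext _ _ _ Cx (FC _ Fy) t0 t1 Fe').
Qed.

(** With equal dimensions, [C] would lie in the affine hull of [F], and so in [F]. *)
Lemma face_dim C F m n : face C F -> F !=set0 -> F <> C ->
  has_dim C m -> has_dim F n -> (n < m)%N.
Proof.
move=> fF F0 FC dC dF; have [sFC _ _] := fF.
rewrite ltn_neqAle (has_dim_le dF dC sFC) andbT.
apply/negP => /eqP nm; rewrite {}nm in dF; apply: FC.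
apply/seteqP; split=> // x Cx; apply: (face_affine_hull fF F0); split=> //.
exact: (affine_hull_dim dF dC sFC).
Qed.

Lemma face_face C F G : face C F -> face C G -> F `<=` G -> face G F.
Proof.
move=> [FC cF extF] [GC cG extG] FG; split=> // x y t Gx Gy.
by apply: extF; exact: GC.
Qed.

(** Among the proper faces containing [F0], one of largest dimension is maximal, since a proper face
    strictly above it would have a larger dimension. *)
Lemma maximal_face_above C F0 : nonempty_faces C F0 -> F0 <> C ->
  exists F, maximal_proper_faces C F /\ F0 `<=` F.
Proof.
move=> [fF0 F00] F0C; have [x0 F0x0] := F00.
have [FC0 _ _] := fF0.
have [m dC] : exists m, has_dim C m.
  by apply: has_dim_exists; exists x0; exact: FC0.
pose Q k := `[< exists F, [/\ nonempty_faces C F, F <> C, F0 `<=` F &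
  has_dim F k] >].
have Q0 : exists k, Q k.
  have [k dk] := has_dim_exists F00.
  by exists k; apply/asboolP; exists F0; split.
have Qm k : Q k -> (k <= d)%N.
  by move=> /asboolP[F [_ _ _ /has_dim_leq]].
case: (ex_maxnP Q0 Qm) => k /asboolP[F [fF FC F0F dF]] kmax.
exists F; split=> //; split=> // F' fF' F'C F'F FF'.
have [k' dF'] := has_dim_exists (proj2 fF').
have : (k < k')%N.
  apply: (face_dim _ (proj2 fF) _ dF' dF).
    exact: face_face (proj1 fF) (proj1 fF') FF'.
  by move=> E; apply: F'F.
rewrite ltnNge kmax//; apply/asboolP; exists F'; split=> //.
exact: subset_trans FF'.
Qed.

Lemma hyperplane_face C a (b : R) : convex C -> C `<=` [set x | dot a x <= b] ->
  face C (C `&` hyperplane a b).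
Proof.
move=> cC Cb; split.
- by move=> x [].
- apply/convex_setP => x y t [Cx xb] [Cy yb] t0 t1; split; first exact: cC.
  by rewrite /hyperplane /= dotDr !dotZr xb yb; ring.
- move=> x y t Cx Cy t0 t1 [_].
  rewrite /hyperplane /= dotDr !dotZr => E.
  have /= xb := Cb _ Cx; have /= yb := Cb _ Cy.
  suff : dot a x = b /\ dot a y = b by move=> [? ?]; split; split.
  (* The two slacks are non-negative and their combination with positive weights vanishes, so both
     are zero. *)
  have h1 : (1 - t) * (b - dot a x) >= 0 by apply: mulr_ge0; lra.
  have h2 : t * (b - dot a y) >= 0 by apply: mulr_ge0; lra.
  have h3 : (1 - t) * (b - dot a x) + t * (b - dot a y) = 0.
    by rewrite -E; ring.
  have {}h1 : (1 - t) * (b - dot a x) = 0 by lra.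
  have {}h2 : t * (b - dot a y) = 0 by lra.
  move/eqP: h1; rewrite mulf_eq0 subr_eq0 gt_eqF//= subr_eq0 => /eqP <-.
  by move/eqP: h2; rewrite mulf_eq0 gt_eqF//= subr_eq0 => /eqP <-.
Qed.

End faces.

(** * A finite-dimensional Hahn-Banach theorem *)

Section sublinear.
Context {R : realType} {d : nat}.
Implicit Types (x y z a u v : 'rV[R]_d) (p q : 'rV[R]_d -> R).

Definition sublinear p :=
  (forall x y, p (x + y) <= p x + p y) /\
  (forall (s : R) x, 0 < s -> p (s *: x) = s * p x).

Lemma sublinear0 p : sublinear p -> p 0 = 0.
Proof.
move=> [_ hp]; have := hp 2 0 (ltr0n _ 2).
by rewrite scaler0 => h; lra.
Qed.

Lemma sublinear_ge0 p x : sublinear p -> 0 <= p x + p (- x).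
Proof.
move=> sp; have [ap _] := sp.
by rewrite -(sublinear0 sp) -{1}(subrr x) ap.
Qed.

Definition flatten_set p z x :=
  [set p (x + t *: z) - t * p z | t in [set t : R | 0 <= t]].

(* The largest sublinear [q <= p] such that [q (- z) = - p z]. *)
Definition flatten p z x : R := inf (flatten_set p z x).

Section flatten_sublinear.
Variables (p : 'rV[R]_d -> R) (z : 'rV[R]_d).
Hypothesis sp : sublinear p.

Let hp t x : 0 <= t -> p (t *: x) = t * p x.
Proof.
rewrite le_eqVlt => /orP[/eqP <-|]; last by case: sp => _; apply.
by rewrite scale0r mul0r sublinear0.
Qed.

(** Subadditivity for [t z = (x + t z) + (- x)]; this keeps the infimum finite. *)
Let lb x : lbound (flatten_set p z x) (- p (- x)).
Proof.
move=> _ [t /= t0 <-]; have [ap _] := sp.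
have := ap (x + t *: z) (- x).
by rewrite addrAC subrr add0r hp//; lra.
Qed.

Let hasinf x : has_inf (flatten_set p z x).
Proof.
split; last by exists (- p (- x)); exact: lb.
by exists (p (x + 0 *: z) - 0 * p z), 0 => //=.
Qed.

Lemma flatten_le x t : 0 <= t -> flatten p z x <= p (x + t *: z) - t * p z.
Proof.
by move=> t0; apply: ge_inf; [case: (hasinf x)|exists t].
Qed.

Lemma flatten_lep x : flatten p z x <= p x.
Proof.
by have := @flatten_le x 0 (lexx _); rewrite scale0r addr0 mul0r subr0.
Qed.

Lemma flatten_opp : flatten p z (- z) <= - p z.
Proof.
have := @flatten_le (- z) 1 ler01.
by rewrite scale1r addNr mul1r sublinear0// sub0r.
Qed.

Lemma flatten_sublinear : sublinear (flatten p z).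
Proof.
have [ap hp'] := sp; split=> [x y|s x s0].
  have : forall e, 0 < e -> flatten p z (x + y) <=
      flatten p z x + flatten p z y + e.
    (* Nearly optimal parameters for [x] and [y] add up to an admissible parameter for [x + y]. *)
    move=> e e0; have e2 : 0 < e / 2 by rewrite divr_gt0.
    have [_ [t /= t0 <-] ht] := inf_adherent e2 (hasinf x).
    have [_ [s /= s0 <-] hs] := inf_adherent e2 (hasinf y).
    have := @flatten_le (x + y) (t + s) (addr_ge0 t0 s0).
    have := ap (x + t *: z) (y + s *: z).
    rewrite addrACA -scalerDl mulrDl -/(flatten p z x) -/(flatten p z y) in ht hs *.
    by rewrite /flatten in ht hs *; lra.
  by move=> h; apply/ler_addgt0Pr => e /h.
(* Rescaling the parameter gives one inequality; the same inequality for the inverse factor gives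
   the other. *)
have le s' x' : 0 < s' -> flatten p z (s' *: x') <= s' * flatten p z x'.
  move=> s'0; rewrite -ler_pdivrMl//; apply: lb_le_inf.
    by case: (hasinf x').
  move=> _ [t /= t0 <-]; rewrite ler_pdivrMl//.
  have := @flatten_le (s' *: x') (s' * t) (mulr_ge0 (ltW s'0) t0).
  by rewrite -scalerA -scalerDr hp'// mulrBr mulrA.
apply/eqP; rewrite eq_le le//=.
have := le s^-1 (s *: x); rewrite invr_gt0 => /(_ s0).
by rewrite scalerA mulVf ?gt_eqF// scale1r ler_pdivlMl.
Qed.

End flatten_sublinear.

(** A sublinear [q <= p] satisfies [0 <= q x + q (- x) <= p x + p (- x) = 0], so directions that are
    already flat stay flat, with the same value. *)
Lemma flatten_linear p z x : sublinear p -> p (- x) = - p x ->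
  flatten p z (- x) = - flatten p z x /\ flatten p z x = p x.
Proof.
move=> sp px.
have h1 := sublinear_ge0 x (flatten_sublinear z sp).
have h2 := flatten_lep z sp x.
have h3 := flatten_lep z sp (- x).
by split; lra.
Qed.

Lemma flatten_flat p z : sublinear p ->
  flatten p z (- z) = - flatten p z z.
Proof.
move=> sp; have h1 := sublinear_ge0 z (flatten_sublinear z sp).
have h2 := flatten_lep z sp z; have h3 := flatten_opp z sp; lra.
Qed.

(** Flatten along the vectors of [s] in turn. The alternative [p (- x) = - p x] in the conclusion
    carries the directions flattened earlier through the induction. *)
Lemma sublinear_flat_on (s : seq 'rV[R]_d) p : sublinear p ->
  exists q, [/\ sublinear q, forall x, q x <= p x &
    forall x, x \in s \/ p (- x) = - p x -> q (- x) = - q x].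
Proof.
elim: s p => [|z s IH] p sp.
  by exists p; split=> // x [].
have [q [sq qp qs]] := IH _ (flatten_sublinear z sp).
exists q; split=> // [x|x [|px]].
- exact: le_trans (qp x) (flatten_lep z sp x).
- rewrite inE => /orP[/eqP ->|xs]; last by apply: qs; left.
  by apply: qs; right; exact: flatten_flat.
- by apply: qs; right; case: (flatten_linear z sp px).
Qed.

(** Subadditivity over the coordinates bounds [q] by the linear form; the same bound at [- x] gives
    the reverse inequality. *)
Lemma sublinear_linear q : sublinear q ->
  (forall i, q (- delta_mx 0 i) = - q (delta_mx 0 i)) ->
  forall x, q x = dot (\row_i q (delta_mx 0 i)) x.
Proof.
move=> sq qd; have [aq hq] := sq.
have hq' (c : R) i : q (c *: delta_mx 0 i) = c * q (delta_mx 0 i).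
  case: (ltgtP c 0) => [c0|c0|->]; last by rewrite scale0r mul0r sublinear0.
    rewrite -[c]opprK scaleNr -scalerN hq ?oppr_gt0// qd; ring.
  by rewrite hq.
have le x : q x <= dot (\row_i q (delta_mx 0 i)) x.
  rewrite {1}[x]row_sum_delta /dot.
  elim/big_rec2 : _ => [|i y1 y2 _ h]; first by rewrite sublinear0.
  apply: le_trans (aq _ _) _; apply: lerD => //.
  by rewrite hq' mxE mulrC.
move=> x; apply/eqP; rewrite eq_le le/=.
have h1 := le (- x); rewrite dotNr in h1.
by have := sublinear_ge0 x sq; lra.
Qed.

Theorem hahn_banach p z : sublinear p ->
  exists a, (forall x, dot a x <= p x) /\ dot a z = p z.
Proof.
move=> sp.
(* Flattening along [z] first pins the value at [z] to [p z]; flattening along the basis vectors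
   then yields a linear form and preserves that value. *)
have [q [sq qp qs]] := sublinear_flat_on [seq delta_mx 0 i | i <- enum 'I_d]
  (flatten_sublinear z sp).
have ql := sublinear_linear sq
  (fun i => qs _ (or_introl (map_f _ (mem_enum _ i)))).
exists (\row_i q (delta_mx 0 i)); split=> [x|].
  by rewrite -ql; apply: le_trans (qp x) (flatten_lep z sp x).
apply/eqP; rewrite eq_le -ql.
rewrite (le_trans (qp z) (flatten_lep z sp z))/=.
have := qp (- z); have := flatten_opp z sp; have := sublinear_ge0 z sq.
rewrite (qs z); last by right; exact: flatten_flat.
by lra.
Qed.

End sublinear.

(** * Separation *)

Section separation.
Context {R : realType} {d : nat}.
Implicit Types (x y z a u v e : 'rV[R]_d) (A B C F : set 'rV[R]_d).

Lemma dot_mulmx_tr m (g : 'rV[R]_m) (N : 'M[R]_(d, m)) x :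
  dot (g *m N^T) x = dot g (x *m N).
Proof.
rewrite /dot.
transitivity ((g *m N^T *m x^T) 0 0).
  by rewrite [RHS]mxE; apply: eq_bigr => i _; congr (_ * _); rewrite mxE.
rewrite -mulmxA -trmx_mul mxE; apply: eq_bigr => i _.
by congr (_ * _); rewrite mxE.
Qed.

Lemma separation_off_hull C v : C !=set0 -> ~ affine_hull C v ->
  exists a, forall x, C x -> dot a x < dot a v.
Proof.
move=> /has_dim_exists[m [x0 [M fM]]] nv; have [Cx0 _ _ CM] := fM.
(* [Q] kills the directions of the affine hull but not [v - x0], so the functional chosen below
   pairs with every [v - x] to the squared norm of [(v - x0) Q]. *)
pose Q := 1%:M - pinvmx M *m M.
have QC x : C x -> (x - x0) *m Q = 0.
  by move=> /CM xM; rewrite mulmxBr mulmx1 mulmxA mulmxKpV// subrr.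
have g0 : (v - x0) *m Q != 0.
  apply: contra_notN nv; rewrite mulmxBr mulmx1 subr_eq0 => /eqP vE.
  by apply/(affine_hull_frame _ fM); rewrite vE mulmxA submxMl.
exists ((v - x0) *m Q *m Q^T) => x Cx.
have QQ : Q *m Q = Q.
  have E : pinvmx M *m M *m (pinvmx M *m M) = pinvmx M *m M.
    by rewrite mulmxA mulmxKpV// submxMl.
  by rewrite /Q mulmxBr mulmx1 mulmxBl mul1mx E subrr subr0.
rewrite -subr_gt0 -dotBr dot_mulmx_tr.
have -> : v - x = (v - x0) - (x - x0) by rewrite opprB addrA subrK.
by rewrite [(_ - (x - x0)) *m Q]mulmxBl (QC x)// subr0 dot_gt0.
Qed.

Section gauge.
Variables (C : set 'rV[R]_d) (e x0 : 'rV[R]_d) (m : nat) (M : 'M[R]_(m, d)).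
Hypotheses (cC : convex C) (Ce : rint C e) (fM : frame C x0 M).

(** [C] may have empty interior; projecting first onto the direction space of its affine hull keeps
    the gauge finite on the whole space. *)
Let pr x := x *m pinvmx M *m M.

Let prD x y : pr (x + y) = pr x + pr y.
Proof. by rewrite /pr !mulmxDl. Qed.

Let prZ s x : pr (s *: x) = s *: pr x.
Proof. by rewrite /pr -!scalemxAl. Qed.

Let prid x : affine_hull C x -> pr (x - e) = x - e.
Proof.
move=> hx; rewrite /pr mulmxKpV//.
have -> : x - e = (x - x0) - (e - x0) by rewrite opprB addrA subrK.
rewrite addmx_sub ?eqmx_opp//; apply/(affine_hull_frame _ fM) => //.
by case: Ce.
Qed.

Definition gauge_set x := [set t : R | 0 < t /\ C (e + t^-1 *: pr x)].

(** The Minkowski functional of [C - e], composed with the projection [pr]. *)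
Definition gauge x := inf (gauge_set x).

Let gauge_inf x : has_inf (gauge_set x).
Proof.
split; last by exists 0 => t [/ltW].
have [he ne] := Ce.
have : \forall s \near (0 : R), affine_hull C (e + s *: pr x) ->
    C (e + s *: pr x).
  have := @line_continuous R d e (pr x) 0.
  by rewrite /continuous_at scale0r addr0 => /(_ _ ne).
move=> /nbhs_ballP[r /= r0 H].
exists (r / 2)^-1; split; first by rewrite invr_gt0 divr_gt0.
rewrite invrK; apply: H.
  rewrite /ball /= sub0r normrN gtr0_norm ?divr_gt0//.
  by rewrite ltr_pdivrMr// ltr_pMr// ltr1n.
apply/(affine_hull_frame _ fM); rewrite addrAC addmx_sub ?scalemx_sub ?submxMl//.
exact/(affine_hull_frame _ fM).
Qed.

Let gauge_le x t : gauge_set x t -> gauge x <= t.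
Proof. by move=> ?; apply: ge_inf => //; case: (gauge_inf x). Qed.

Lemma gauge_sublinear : sublinear gauge.
Proof.
split=> [x y|s x s0].
  apply/ler_addgt0Pr => r r0; have r2 : 0 < r / 2 by rewrite divr_gt0.
  have [t [t0 Ct] ht] := inf_adherent r2 (gauge_inf x).
  have [s [s0 Cs] hs] := inf_adherent r2 (gauge_inf y).
  suff /gauge_le : gauge_set (x + y) (t + s) by rewrite /gauge in ht hs *; lra.
  split; first exact: addr_gt0.
  have ts0 : 0 < t + s by exact: addr_gt0.
  have r01 : 0 <= s / (t + s) by rewrite divr_ge0// ltW.
  have r11 : s / (t + s) <= 1 by rewrite ler_pdivrMr// mul1r lerDr ltW.
  (* The combination of the two witnesses with weight [s / (t + s)] on the second is exactly the
     point required for [t + s]. *)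
  move: (cC Ct Cs r01 r11); congr C; rewrite prD.
  by apply/rowP => j; rewrite !mxE; field; rewrite !gt_eqF ?addr_gt0.
have le s' x' : 0 < s' -> gauge (s' *: x') <= s' * gauge x'.
  move=> s'0; rewrite -ler_pdivrMl//; apply: lb_le_inf.
    by case: (gauge_inf x').
  move=> t [t0 Ct]; rewrite ler_pdivrMl//; apply: gauge_le.
  split; first exact: mulr_gt0.
  move: Ct; congr C; rewrite prZ scalerA; congr (_ + _ *: _).
  by field; rewrite !gt_eqF.
apply/eqP; rewrite eq_le le//=.
have := le s^-1 (s *: x); rewrite invr_gt0 => /(_ s0).
by rewrite scalerA mulVf ?gt_eqF// scale1r ler_pdivlMl.
Qed.

Lemma gauge_le1 x : C x -> gauge (x - e) <= 1.
Proof.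
move=> Cx; apply: gauge_le; split=> //.
rewrite prid; last exact: affine_hull_sub.
by rewrite invr1 scale1r addrC subrK.
Qed.

(** A gauge below 1 would put [v] on a segment from a point of [C] to [e], with positive weight at
    [e], hence in the relative interior. *)
Lemma gauge_ge1 v : affine_hull C v -> ~ rint C v -> 1 <= gauge (v - e).
Proof.
move=> hv nv; rewrite leNgt; apply/negP => g1; apply: nv.
have r0 : 0 < 1 - gauge (v - e) by rewrite subr_gt0.
have [t [t0 Ct] ht] := inf_adherent r0 (gauge_inf (v - e)).
have t1 : t < 1 by rewrite /gauge in ht; lra.
rewrite prid// in Ct.
have := @rint_segment _ _ C _ _ (1 - t) cC Ct Ce.
rewrite subr_gt0 => /(_ t1); rewrite lerBlDr lerDl ltW// => /(_ isT).
by congr (rint C _); apply/rowP => j; rewrite !mxE; field; rewrite gt_eqF.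
Qed.

End gauge.

(** On the affine hull, take a functional below the gauge and equal to it at [v - e]: it is at most
    1 on [C - e] and at least 1 at [v - e]. The point [e], where it gives 0, makes the separation
    proper. *)
Theorem proper_separation C v : convex C -> C !=set0 -> ~ rint C v ->
  exists a, (forall x, C x -> dot a x <= dot a v) /\
            (exists2 x, C x & dot a x < dot a v).
Proof.
move=> cC C0 nv; have [hv|hv] := pselect (affine_hull C v); last first.
  have [a ha] := separation_off_hull C0 hv; exists a; split.
    by move=> x /ha/ltW.
  by case: C0 => x Cx; exists x; [|exact: ha].
have [e Ce] := rint_exists cC C0.
have [m [x0 [M fM]]] := has_dim_exists C0.
have [a [ap az]] := hahn_banach (v - e) (gauge_sublinear cC Ce fM).
have v1 := gauge_ge1 cC Ce fM hv nv.
exists a; split=> [x Cx|].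
  have := gauge_le1 Ce fM Cx; have := ap (x - e).
  by rewrite -az !dotBr in v1 *; lra.
exists e; first exact: rint_sub.
by rewrite -az dotBr in v1; lra.
Qed.

(** Separating a relative interior point [e] of [F] from [C] exposes a proper face that contains
    [F]; maximality makes it equal to [F]. *)
Lemma maximal_face_exposed C F : convex C -> maximal_proper_faces C F ->
  exists a b, [/\ a != 0, C `<=` [set x | dot a x <= b] &
                  F = C `&` hyperplane a b].
Proof.
move=> cC [[fF F0] FC Fmax].
have [FsC _ ext] := fF.
have [e Fe] := rint_exists (face_convex fF) F0.
have Ce := FsC _ (rint_sub Fe).
have nCe : ~ rint C e.
  (* Otherwise every point of [C] would be an endpoint of a segment of [C] through [e], and
     extremality would give [F = C]. *)
  move=> rCe; apply: FC; apply/seteqP; split=> // x Cx.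
  have [y [t [Cy t0 t1 eE]]] := rint_prolong rCe (affine_hull_sub Cx).
  have := rint_sub Fe; rewrite eE => /(ext _ _ _ Cx Cy t0 t1).
  by case.
have [a [ale [y Cy ay]]] := proper_separation cC (ex_intro _ e Ce) nCe.
exists a, (dot a e).
have a0 : a != 0.
  by apply: contraTneq ay => ->; rewrite !dot0l ltxx.
split=> //; apply: contrapT => FE.
have fG := hyperplane_face cC ale.
apply: (Fmax (C `&` hyperplane a (dot a e))) => //.
- by split=> //; exists e.
- by move=> E; move: Cy; rewrite -E => -[_]; rewrite /hyperplane /=; lra.
- by move=> E; apply: FE.
- move=> x Fx; split; first exact: FsC.
  (* A linear form that attains its maximum over [F] at a relative interior point is constant on
     [F]. *)
  have [z [t [Fz t0 t1 eE]]] := rint_prolong Fe (affine_hull_sub Fx).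
  have := ale _ (FsC _ Fz); have := ale _ (FsC _ Fx).
  rewrite /hyperplane /= => xe ze.
  have : dot a e = (1 - t) * dot a x + t * dot a z.
    by rewrite {1}eE dotDr !dotZr.
  move=> E; apply/eqP; rewrite eq_le xe /=.
  rewrite -subr_ge0 -(pmulr_rge0 _ (_ : 0 < 1 - t)) ?subr_gt0//.
  have : 0 <= t * (dot a e - dot a z) by apply: mulr_ge0; lra.
  by lra.
Qed.

End separation.

(** * Measurability of convex hulls *)

Section hull_measurable.
Context {R : realType} {d : nat}.
Implicit Types (x y z : 'rV[R]_d) (S A B C : set 'rV[R]_d).

Lemma open_measurable_rV A : open A -> measurable (A : set (borel_rV R d)).
Proof. by move=> oA; exact: sub_sigma_algebra. Qed.

Lemma closed_measurable_rV A : closed A -> measurable (A : set (borel_rV R d)).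
Proof.
by move=> cA; rewrite -[A]setCK; apply: measurableC; apply: open_measurable_rV;
  exact: closed_openC.
Qed.

Lemma convex_hull_convex S : convex (convex_hull S).
Proof.
move=> x y t Sx Sy t0 t1 B hB; have [/convex_setP cB _] := hB.
by apply: cB => //; [exact: Sx|exact: Sy].
Qed.

Lemma convex_hull_sub S : S `<=` convex_hull S.
Proof. by move=> x Sx B [_]; exact. Qed.

Lemma convex_hull_min S A : convex A -> S `<=` A -> convex_hull S `<=` A.
Proof. by move=> /convex_setP cA SA x; apply. Qed.

Definition segments A : set 'rV[R]_d :=
  (fun p : R * ('rV[R]_d * 'rV[R]_d) => (1 - p.1) *: p.2.1 + p.1 *: p.2.2)
    @` (`[0, 1] `*` (A `*` A)).

Lemma segments_compact A : compact A -> compact (segments A).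
Proof.
move=> cA; apply: continuous_compact; last first.
  by apply: compact_setX; [exact: segment_compact|exact: compact_setX].
apply: continuous_subspaceT => p.
apply: (@cvgD _ _ _ (nbhs p)).
  apply: (@cvgZ _ _ _ (nbhs p)).
    apply: (@cvgB _ _ _ (nbhs p)); first exact: cvg_cst.
    exact: cvg_fst.
  apply: (@cvg_comp _ _ _ snd fst); [exact: cvg_snd|exact: cvg_fst].
apply: (@cvgZ _ _ _ (nbhs p)); first exact: cvg_fst.
apply: (@cvg_comp _ _ _ snd snd); exact: cvg_snd.
Qed.

(** The convex hull of a closed set need not be closed. Adding the points of [S] of bounded norm and
    taking segments, repeatedly, gives increasing compact stages whose union is the hull, which is
    therefore Borel. *)
Fixpoint hull_stage S n : set 'rV[R]_d :=
  if n is m.+1 then segments (hull_stage S m `|` (S `&` [set x | `|x| <= m%:R]))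
  else set0.

Lemma segments_sub A : A `<=` segments A.
Proof.
move=> x Ax; exists (0, (x, x)) => /=; last by rewrite subr0 scale1r scale0r addr0.
by split=> //=; rewrite in_itv /= lexx ler01.
Qed.

Lemma hull_stage_compact S n : closed S -> compact (hull_stage S n).
Proof.
move=> cS; elim: n => [|n IH]; first exact: compact0.
apply: segments_compact; apply: compactU => //.
apply: bounded_closed_compact.
  exists n%:R; split; first exact: num_real.
  by move=> r nr x [_ /= xn]; rewrite (le_trans xn)// ltW.
apply: closedI => //.
apply: (@closed_comp _ _ (fun x : 'rV[R]_d => `|x|) [set r | r <= n%:R]).
  by move=> x _; exact: norm_continuous.
exact: closed_le.
Qed.

Lemma hull_stage_le S m n : (m <= n)%N -> hull_stage S m `<=` hull_stage S n.
Proof.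
elim: n => [|n IH]; first by rewrite leqn0 => /eqP ->.
rewrite leq_eqVlt => /orP[/eqP -> //|/IH mn] x /mn Hx.
by apply: segments_sub; left.
Qed.

Lemma convex_hullE S : convex_hull S = \bigcup_n hull_stage S n.
Proof.
apply/seteqP; split.
  apply: convex_hull_min => [x y t [m _ Hx] [n _ Hy] t0 t1|x Sx].
    exists (maxn m n).+1 => //; exists (t, (x, y)) => //=.
    split=> /=; first by rewrite in_itv /= t0 t1.
    by split; left; apply: hull_stage_le; [exact: leq_maxl|exact: Hx|
      exact: leq_maxr|exact: Hy].
  have [n xn] : exists n, `|x| <= n%:R.
    by exists (Num.bound `|x|); apply/ltW/archi_boundP.
  by exists n.+1 => //; apply: segments_sub; right.
apply: bigcup_sub => n _; elim: n => [//|n IH] _ [[t [x y]] /= [+ [Hx Hy]] <-].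
rewrite in_itv /= => /andP[t0 t1].
have H z : (hull_stage S n `|` S `&` [set x | `|x| <= n%:R]) z ->
    convex_hull S z.
  by move=> [/IH//|[Sz _]]; exact: convex_hull_sub.
by apply: convex_hull_convex => //; exact: H.
Qed.

Lemma convex_hull_measurable S : closed S ->
  measurable (convex_hull S : set (borel_rV R d)).
Proof.
move=> cS; rewrite convex_hullE; apply: bigcup_measurable => n _.
apply: closed_measurable_rV; apply: compact_closed; first exact: norm_hausdorff.
exact: hull_stage_compact.
Qed.

Lemma hyperplane_closed (a : 'rV[R]_d) (b : R) : closed (hyperplane a b).
Proof.
apply: (@closed_comp _ _ (dot a) [set b]); last exact: closed_eq.
by move=> x _; exact: dot_continuous.
Qed.

Lemma halfspace_closed (a : 'rV[R]_d) (b : R) : closed [set x | dot a x <= b].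
Proof.
apply: (@closed_comp _ _ (dot a) [set r | r <= b]); last exact: closed_le.
by move=> x _; exact: dot_continuous.
Qed.

End hull_measurable.

(** * Conditioning *)

Section conditioning.
Context {disp : measure_display} {T : measurableType disp} {R : realType}.
Implicit Types (P Q : probability T R) (A B : set T).

(** Turns a setwise computation of nested conditionings into an equality of probabilities, along
    which any predicate can be rewritten. *)
Lemma probability_eq P Q : (P : set T -> \bar R) = Q -> P = Q.
Proof.
move=> PQ; case: P Q PQ => [p cp] [q cq] /= pq; subst q; congr Probability.Pack.
case: cp cq => [[a1 a2] [a3] [a4] [a5] [a6] [a7] [a8]].
move=> [[b1 b2] [b3] [b4] [b5] [b6] [b7] [b8]].
rewrite (Prop_irrelevance b1 a1) (Prop_irrelevance b2 a2).
rewrite (Prop_irrelevance b3 a3) (Prop_irrelevance b4 a4).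
rewrite (Prop_irrelevance b5 a5) (Prop_irrelevance b6 a6).
by rewrite (Prop_irrelevance b7 a7) (Prop_irrelevance b8 a8).
Qed.

Lemma probability1_setC P A : measurable A -> P A = 1%E <-> P (~` A) = 0%E.
Proof.
move=> mA; rewrite probability_setC//; split=> [->|]; first by rewrite subee.
rewrite -(fineK (fin_num_measure P A mA)) -EFinB => /eqP.
by rewrite eqe subr_eq0 => /eqP <-.
Qed.

Lemma probability1_sub P A B : measurable A -> measurable B -> A `<=` B ->
  P A = 1%E -> P B = 1%E.
Proof.
move=> mA mB AB PA; apply/eqP; rewrite eq_le probability_le1//= -PA.
by rewrite le_measure ?inE.
Qed.

Lemma probability_setI1 P A B : measurable A -> measurable B ->
  P A = 1%E -> P (B `&` A) = P B.
Proof.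
move=> mA mB /(probability1_setC P mA) PA0.
rewrite -[in RHS](setIT B) -(setvU A) setIUr measureU.
- rewrite [X in (X + _)%E](_ : _ = 0%E) ?add0e//.
  by apply: (@subset_measure0 _ _ _ P _ (~` A)) => //;
    [exact: measurableI (measurableC mA)|exact: measurableC].
- exact: measurableI (measurableC mA).
- exact: measurableI.
- by rewrite setIACA setICl setI0.
Qed.

Lemma cond_prob_setE P A B C : A `<=` C -> measurable A -> measurable C ->
  (0 < P A)%E -> cond_prob (cond_prob P C) A B = cond_prob P A B.
Proof.
move=> AC mA mC PA.
have PC : (0 < P C)%E by apply: lt_le_trans PA _; rewrite le_measure ?inE.
have CAE : (C `&` A = A) by apply/setIidPr.
have CA : cond_prob P C A = (P A * (fine (P C))^-1%:E)%E.
  by rewrite cond_probE// setIC CAE.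
have fC := fineK (fin_num_measure P C mC).
have fA := fineK (fin_num_measure P A mA).
have C0 : 0 < fine (P C) by rewrite -lte_fin fC.
have A0 : 0 < fine (P A) by rewrite -lte_fin fA.
rewrite cond_probE//; last first.
  by rewrite CA -fA -EFinM lte_fin divr_gt0.
rewrite CA cond_probE// cond_probE// -setIA (setIC A) CAE.
rewrite -muleA; congr (_ * _)%E.
have -> : fine (P A * ((fine (P C))^-1)%:E)%E = fine (P A) / fine (P C).
  by rewrite -{1}fA.
rewrite -EFinM; congr (_%:E).
by rewrite invfM invrK mulrCA mulVf ?gt_eqF// mulr1.
Qed.

Lemma cond_prob_cond P A C : A `<=` C -> measurable A -> measurable C ->
  (0 < P A)%E -> cond_prob (cond_prob P C) A = cond_prob P A.
Proof.
move=> AC mA mC PA; apply: probability_eq; apply/funext => B.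
exact: cond_prob_setE.
Qed.

Lemma cond_prob_gt0 P A C : measurable A -> measurable C ->
  (0 < cond_prob P C A)%E -> (0 < P A)%E.
Proof.
move=> mA mC; have [PC|] := ltP 0%E (P C).
  rewrite cond_probE// lt0e => /andP[H _].
  rewrite lt0e measure_ge0 andbT; apply: contra H => /eqP PA0.
  rewrite (_ : P (A `&` C) = 0%E) ?mul0e//.
  exact: (@subset_measure0 _ _ _ P _ A (measurableI _ _ mA mC) mA
    (@subIsetl _ _ _) PA0).
(* When [C] is null, [cond_prob] takes its default value [P], and the claim is the hypothesis. *)
rewrite measure_le0 => /eqP PC0.
by rewrite /cond_prob; case: pselect => // mC';
  rewrite /= /mnormalize /= /mrestr setTI PC0 eqxx.
Qed.

Lemma cond_prob1 P A C : measurable A -> measurable C ->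
  P A = 1%E -> cond_prob P C A = 1%E.
Proof.
move=> mA mC PA; have [PC|] := ltP 0%E (P C).
  rewrite cond_probE// setIC probability_setI1//.
  rewrite -{1}(fineK (fin_num_measure P C mC)) -EFinM divff//.
  by rewrite -eqe (fineK (fin_num_measure P C mC)) gt_eqF.
rewrite measure_le0 => /eqP PC0.
by rewrite /cond_prob; case: pselect => // mC';
  rewrite /= /mnormalize /= /mrestr setTI PC0 eqxx.
Qed.

Lemma cond_prob_self P C : measurable C -> (0 < P C)%E -> cond_prob P C C = 1%E.
Proof.
move=> mC PC; rewrite cond_probE// setIid.
rewrite -{1}(fineK (fin_num_measure P C mC)) -EFinM divff//.
by rewrite -eqe (fineK (fin_num_measure P C mC)) gt_eqF.
Qed.

Lemma integral_prob1 P A (f : T -> \bar R) : measurable A -> P A = 1%E ->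
  measurable_fun setT f -> (forall t, 0 <= f t)%E ->
  (\int[P]_t f t = \int[P]_(t in A) f t)%E.
Proof.
move=> mA /(probability1_setC P mA) PA mf f0.
rewrite (@ge0_negligible_integral _ _ _ P setT (~` A))//; last exact: measurableC.
by rewrite setTD setCK.
Qed.

Lemma integral_cond_prob P C (f : T -> \bar R) : measurable C -> (0 < P C)%E ->
  measurable_fun setT f -> (forall t, 0 <= f t)%E ->
  (\int[cond_prob P C]_t f t = ((fine (P C))^-1)%:E * \int[P]_(t in C) f t)%E.
Proof.
move=> mC PC mf f0; rewrite (integral_prob1 mC)//; last exact: cond_prob_self.
have i0 : 0 <= (fine (P C))^-1 by rewrite invr_ge0 fine_ge0.
(* On subsets of [C] the conditional measure is [P] scaled by the inverse of [P C]. *)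
transitivity (\int[mscale (NngNum i0) P]_(t in C) f t)%E.
  apply: eq_measure_integral => A mA AC.
  rewrite [LHS](cond_probE A mC PC) /mscale /= muleC; congr (_ * P _)%E.
  exact/setIidPl.
by rewrite ge0_integral_mscale//; exact: measurable_funTS.
Qed.

End conditioning.

(** * Support *)

Section support.
Context {disp : measure_display} {T : measurableType disp} {R : realType}
  {d : nat} (X : {mfun T >-> borel_rV R d}).
Implicit Types (P : probability T R) (S U : set 'rV[R]_d) (x u v a : 'rV[R]_d).

Lemma preimage_measurable S : measurable (S : set (borel_rV R d)) ->
  measurable (X @^-1` S).
Proof. exact: measurable_funPTI. Qed.

Lemma open_preimage U : open U -> measurable (X @^-1` U).
Proof. by move=> oU; apply: preimage_measurable; exact: open_measurable_rV. Qed.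

Lemma closed_preimage S : closed S -> measurable (X @^-1` S).
Proof. by move=> cS; apply: preimage_measurable; exact: closed_measurable_rV. Qed.

Lemma supp_closed P : closed (supp P X).
Proof. by apply: closed_bigI => S []. Qed.

Lemma supp_min P S : closed S -> P (X @^-1` S) = 1%E -> supp P X `<=` S.
Proof. by move=> cS PS x; apply. Qed.

Lemma supp_open_gt0 P U x : supp P X x -> open U -> U x ->
  (0 < P (X @^-1` U))%E.
Proof.
move=> sx oU Ux; rewrite lt0e measure_ge0 andbT; apply/eqP => PU.
have := sx (~` U); apply => //; split; first exact: open_closedC.
rewrite preimage_setC; apply/probability1_setC; last by rewrite setCK.
by apply: measurableC; exact: open_preimage.
Qed.

Lemma rat_near (y e : R) : 0 < e -> exists q : rat, `|ratr q - y| < e.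
Proof.
move=> e0; have [q] := @rat_in_itvoo R (y - e) (y + e) (ltac:(lra)).
by rewrite in_itv /= => /andP[h1 h2]; exists q; rewrite ltr_norml; lra.
Qed.

Lemma rV_rat_near x (e : R) : 0 < e ->
  exists q : 'rV[rat]_d, ball (map_mx ratr q : 'rV[R]_d) e x.
Proof.
move=> e0.
have [f hf] := boolp.choice (fun i : 'I_d => rat_near (x 0 i) e0).
exists (\row_i f i); split=> // i j; rewrite ord1 !mxE.
exact: hf.
Qed.

(** Each point outside the support has a null ball around it with rational centre and radius
    [1 / (n + 1)], and there are only countably many such balls. *)
Lemma supp_full P : P (X @^-1` supp P X) = 1%E.
Proof.
apply/probability1_setC; first by apply: closed_preimage; exact: supp_closed.
have msupp : measurable (~` (X @^-1` supp P X)).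
  by apply: measurableC; apply: closed_preimage; exact: supp_closed.
apply: measure_negligible => //.
pose B (c : 'rV[rat]_d * nat) :=
  X @^-1` ball (map_mx ratr c.1 : 'rV[R]_d) (c.2.+1%:R^-1).
have mB c : measurable (B c).
  by apply: open_preimage; apply: ball_open; rewrite invr_gt0 ltr0n.
(* Codes that denote no ball, or a ball of positive probability, contribute the empty set. *)
pose F n := if unpickle n is Some c then
  (if P (B c) == 0%E then B c else set0) else set0.
apply: (@negligibleS _ _ _ P (\bigcup_n F n)); last first.
  apply: negligible_bigcup => n; rewrite /F.
  case: (unpickle n) => [c|]; last exact: negligible_set0.
  case: ifPn => [/eqP PB|_]; last exact: negligible_set0.
  by apply/negligibleP.
move=> t /= /existsNP[S /not_implyP[[cS PS] nSt]].
have : nbhs (X t : 'rV[R]_d) (~` S).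
  by apply: open_nbhs_nbhs; split=> //; exact: closed_openC.
move=> /nbhs_ballP[r /= r0 rS].
have [n hn] : exists n : nat, n.+1%:R^-1 < r / 2.
  exists (Num.bound (r / 2)^-1); rewrite -[ltRHS]invrK.
  rewrite ltf_pV2 ?posrE ?invr_gt0 ?divr_gt0 ?ltr0n//.
  apply: lt_le_trans (archi_boundP _) _; first by rewrite invr_ge0 ltW// divr_gt0.
  by rewrite ler_nat.
have n0 : 0 < n.+1%:R^-1 :> R by rewrite invr_gt0 ltr0n.
have [q hq] := rV_rat_near (X t) n0.
exists (pickle (q, n)) => //; rewrite /F pickleK.
suff -> : P (B (q, n)) = 0%E by rewrite eqxx.
apply: (@subset_measure0 _ _ _ P _ (~` (X @^-1` S))) => //.
- by apply: measurableC; exact: closed_preimage.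
- move=> s Bs /=; apply: rS.
  apply: (@le_ball _ _ _ (n.+1%:R^-1 + n.+1%:R^-1)).
    by move: hn; set z := (n.+1%:R)^-1; lra.
  by apply: ball_triangle Bs; exact: ball_sym.
- by apply/probability1_setC => //; exact: closed_preimage.
Qed.

Lemma supp_neq0 P : supp P X !=set0.
Proof.
apply/set0P/eqP => s0; have := supp_full P.
by rewrite s0 preimage_set0 measure0 => /esym/eqP; rewrite onee_eq0.
Qed.

Lemma convsupp_neq0 P : convsupp P X !=set0.
Proof. by case: (supp_neq0 P) => x Sx; exists x; exact: convex_hull_sub. Qed.

Lemma convsupp_convex P : convex (convsupp P X).
Proof. exact: convex_hull_convex. Qed.

Lemma convsupp_preimage P : measurable (X @^-1` convsupp P X).
Proof.
by apply: preimage_measurable; apply: convex_hull_measurable; exact: supp_closed.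
Qed.

Lemma convsupp_full P : P (X @^-1` convsupp P X) = 1%E.
Proof.
apply: probability1_sub (supp_full P).
- by apply: closed_preimage; exact: supp_closed.
- exact: convsupp_preimage.
- by move=> t /= /convex_hull_sub.
Qed.

Lemma convsupp_min P A : closed A -> convex A -> P (X @^-1` A) = 1%E ->
  convsupp P X `<=` A.
Proof. by move=> cA kA PA; apply: convex_hull_min => //; exact: supp_min. Qed.

Lemma supp_given P A : measurable (X @^-1` A) -> supp (given P X A) X `<=` supp P X.
Proof.
move=> mA; apply: supp_min; first exact: supp_closed.
apply: cond_prob1 => //; last exact: supp_full.
by apply: closed_preimage; exact: supp_closed.
Qed.

Lemma convsupp_given P A : measurable (X @^-1` A) ->
  convsupp (given P X A) X `<=` convsupp P X.
Proof.
move=> mA; apply: convex_hull_min; first exact: convsupp_convex.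
by apply: subset_trans (supp_given mA) _; exact: convex_hull_sub.
Qed.

Lemma charged_face_exposed P C : charged_maximal_faces P X C ->
  exists a b, [/\ a != 0, convsupp P X `<=` [set x | dot a x <= b] &
                  C = convsupp P X `&` hyperplane a b].
Proof. by move=> [mC _]; apply: maximal_face_exposed => //; exact: convsupp_convex. Qed.

Lemma charged_face_preimage P C : charged_maximal_faces P X C ->
  measurable (X @^-1` C).
Proof.
move=> /charged_face_exposed[a [b [_ _ ->]]]; rewrite preimage_setI.
apply: measurableI; first exact: convsupp_preimage.
by apply: closed_preimage; exact: hyperplane_closed.
Qed.

Lemma hyperplane_convex a (b : R) : convex (hyperplane a b).
Proof.
move=> x y t xb yb _ _; rewrite /hyperplane /= dotDr !dotZr xb yb; ring.
Qed.

(** [C] need not be closed, so minimality of the support is applied to the exposing hyperplane and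
    combined with the inclusion in the larger hull. *)
Lemma convsupp_charged_face P C : charged_maximal_faces P X C ->
  convsupp (given P X C) X `<=` C.
Proof.
move=> cC; have mC := charged_face_preimage cC.
have [a [b [_ _ CE]]] := charged_face_exposed cC.
rewrite {2}CE subsetI; split; first exact: convsupp_given.
apply: convsupp_min; [exact: hyperplane_closed|exact: hyperplane_convex|].
have mh : measurable (X @^-1` hyperplane a b).
  by apply: closed_preimage; exact: hyperplane_closed.
have := cond_prob_self mC (proj2 cC); apply: probability1_sub => //.
by rewrite CE preimage_setI; exact: subIsetr.
Qed.

End support.

(** * Points of finite rate *)

Section rate.
Context {disp : measure_display} {T : measurableType disp} {R : realType}
  {d : nat} (X : {mfun T >-> borel_rV R d}).
Implicit Types (P : probability T R) (S U : set 'rV[R]_d) (x u v a : 'rV[R]_d).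

Definition mgf P u : \bar R := (\int[P]_t (expR (dot u (X t)))%:E)%E.

(* [v] has a finite rate iff the exponential of minus its rate, a positive
   number, bounds [exp (- u . v) E exp (u . X)] from below for all [u]. *)
Definition finite_rate P : set 'rV[R]_d :=
  [set v | exists2 c : R, 0 < c &
    forall u, ((c * expR (dot u v))%:E <= mgf P u)%E].

Lemma cumulantE P u : cumulant P X u = lne (mgf P u).
Proof. by rewrite /cumulant unlock. Qed.

Lemma mgf_ge0 P u : (0 <= mgf P u)%E.
Proof. by apply: integral_ge0 => t _; rewrite lee_fin expR_ge0. Qed.

Lemma cumulant_domainE P :
  effective_domain (cumulant P X) = [set u | (mgf P u < +oo)%E].
Proof.
apply/seteqP; split=> u /=; rewrite /effective_domain /= cumulantE.
  by case: (mgf P u) (mgf_ge0 P u) => [r| |] //; rewrite ltry.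
case: (mgf P u) => [r| |] //= _.
by case: ifP; rewrite ?ltNyr ?ltry.
Qed.

Lemma finite_rateE P : effective_domain (rate_function P X) = finite_rate P.
Proof.
apply/seteqP; split=> v; rewrite /effective_domain /=.
  move=> rv; have [M hM] : exists M : R, forall u,
      ((dot u v)%:E - cumulant P X u <= M%:E)%E.
    have ub u : ((dot u v)%:E - cumulant P X u <= rate_function P X v)%E.
      by apply: ereal_sup_ubound; exists u.
    case: (rate_function P X v) rv ub => [r| |] // _ ub; first by exists r.
    by exists 0 => u; apply: le_trans (ub u) _; rewrite leNye.
  exists (expR (- M)); first exact: expR_gt0.
  move=> u; have := hM u; rewrite cumulantE.
  case: (mgf P u) (mgf_ge0 P u) => [r| |] // r0; last by rewrite leey.
  rewrite lee_fin in r0.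
  have [r00|rn0] := eqVneq r 0; first by rewrite r00 /lne lexx.
  have rp : 0 < r by rewrite lt_neqAle eq_sym rn0.
  rewrite lne_EFin// -EFinB !lee_fin => h.
  by rewrite -expRD -[leRHS]lnK ?posrE// ler_expR; lra.
move=> [c c0 hc]; apply: (@le_lt_trans _ _ (- ln c)%:E); last by rewrite ltry.
apply: ge_ereal_sup => _ [u _ <-]; rewrite cumulantE.
have := hc u; have := mgf_ge0 P u.
case: (mgf P u) => [r _| |] //; last by move=> _ _; rewrite /= addeNy leNye.
rewrite lee_fin => h; have r0 : 0 < r.
  by apply: lt_le_trans h; rewrite mulr_gt0// expR_gt0.
rewrite lne_EFin// -EFinB lee_fin.
have : ln (c * expR (dot u v)) <= ln r.
  by rewrite ler_ln ?posrE// mulr_gt0// expR_gt0.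
by rewrite lnM ?posrE ?expR_gt0// expRK; lra.
Qed.

Lemma dot_measurable u : measurable_fun setT (fun t => dot u (X t)).
Proof.
apply: (measurability _ (RGenOInfty.measurableE R)) => _ [_ [r ->] <-].
rewrite setTI; apply: (@open_preimage _ _ _ _ X [set x | dot u x \in `]r, +oo[]).
apply: (@open_comp _ _ (dot u) `]r, +oo[%classic).
  by move=> x _; exact: dot_continuous.
exact: interval_open.
Qed.

Lemma expdot_measurable u :
  measurable_fun setT (fun t => (expR (dot u (X t)))%:E).
Proof.
by apply/measurable_EFinP; apply: measurableT_comp => //; exact: dot_measurable.
Qed.

Lemma finite_rate_convex P : convex (finite_rate P).
Proof.
move=> v0 v1 t [c0 c00 h0] [c1 c10 h1] t0 t1.
exists (Num.min c0 c1); first by rewrite lt_min c00.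
(* The product of [u] with the combination is at most the larger of the two end values, so the bound
   at that end suffices; by symmetry it is [v1]. *)
move=> u; wlog h : v0 v1 c0 c1 t c00 c10 h0 h1 t0 t1 / dot u v0 <= dot u v1.
  move=> H; have [h|h] := leP (dot u v0) (dot u v1); first exact: H.
  rewrite minC addrC -[X in X *: v1](subKr 1).
  by apply: H => //; rewrite ?subr_ge0 ?gerBl// ltW.
apply: le_trans (h1 u); rewrite lee_fin; apply: ler_pM => //.
- by rewrite le_min !ltW.
- by rewrite ge_min lexx orbT.
- rewrite ler_expR dotDr !dotZr.
  have : 0 <= (1 - t) * (dot u v1 - dot u v0) by rewrite mulr_ge0 ?subr_ge0.
  by lra.
Qed.

Lemma finite_rate_hyperplane P a (b : R) v :
  P (X @^-1` hyperplane a b) = 1%E -> finite_rate P v -> hyperplane a b v.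
Proof.
move=> Pab [c c0 hc]; rewrite /hyperplane /=; apply/eqP; rewrite -subr_eq0.
apply/negPn/negP => ab0; set y := dot a v - b in ab0.
(* At [u = s a] the generating function is [exp (s b)], so the bound reads [c exp (s y) <= 1]. This
   choice of [s] gives [c exp (1 / c) <= 1], whereas [c exp (1 / c) >= c + 1]. *)
pose s := c^-1 / y.
have mh : measurable (X @^-1` hyperplane a b).
  by apply: closed_preimage; exact: hyperplane_closed.
have := hc (s *: a).
rewrite /mgf (integral_prob1 mh Pab (expdot_measurable _)); last first.
  by move=> t; rewrite lee_fin expR_ge0.
rewrite (eq_integral (cst (expR (s * b))%:E)); last first.
  by move=> t; rewrite inE /= => Ht; rewrite dotZl Ht.
rewrite integral_cst// [X in (_ * X)%E]Pab mule1 lee_fin dotZl.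
have -> : s * dot a v = c^-1 + s * b.
  by rewrite -[dot a v](subrK b) -/y mulrDr mulfVK.
rewrite expRD mulrA ger_pMl ?expR_gt0//.
have := expR_ge1Dx c^-1; rewrite leNgt => h h'.
have : c * (1 + c^-1) <= c * expR c^-1 by rewrite ler_pM2l// leNgt.
by rewrite mulrDr mulr1 divff ?gt_eqF//; lra.
Qed.

Lemma bounded_dot u (r : R) x : `|x| <= r -> `|dot u x| <= (\sum_i `|u 0 i|) * r.
Proof.
move=> xr; apply: le_trans (ler_norm_sum _ _ _) _; rewrite mulr_suml.
apply: ler_sum => i _; rewrite normrM ler_wpM2l//; apply: le_trans xr.
rewrite [leRHS](mx_normrE x); apply/bigmax_geP; right => /=.
by exists (0, i).
Qed.

Lemma bounded_dot_integrable P B u (r : R) : measurable B ->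
  (forall t, B t -> `|X t : 'rV[R]_d| <= r) ->
  P.-integrable B (EFin \o (fun t => dot u (X t))).
Proof.
move=> mB Br; apply: measurable_bounded_integrable => //.
- by rewrite (le_lt_trans (probability_le1 P mB)) ?ltry.
- by apply: measurable_funTS; exact: dot_measurable.
- exists ((\sum_i `|u 0 i|) * r); split; first exact: num_real.
  move=> s hs t Bt; apply: le_trans (ltW hs); apply: bounded_dot; exact: Br.
Qed.

(** The vector is built from the conditional means of the coordinates; boundedness supplies
    integrability, and linearity covers every direction [u]. *)
Lemma conditional_mean P B (r : R) : measurable B -> (0 < P B)%E ->
  (forall t, B t -> `|X t : 'rV[R]_d| <= r) ->
  exists v, forall u,
    (\int[P]_(t in B) (dot u (X t))%:E)%E = (fine (P B) * dot u v)%:E.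
Proof.
move=> mB PB Br.
have iB u : P.-integrable B (EFin \o (fun t => dot u (X t))).
  exact: bounded_dot_integrable mB Br.
have PB0 : fine (P B) != 0.
  by rewrite -eqe (fineK (fin_num_measure P B mB)) gt_eqF.
pose m (i : 'I_d) := (\int[P]_(t in B) (dot (delta_mx 0 i) (X t))%:E)%E.
exists (\row_i (fine (m i) / fine (P B))) => u.
have dotE t : (dot u (X t))%:E =
    (\sum_i (u 0 i)%:E * (dot (delta_mx 0 i) (X t))%:E)%E.
  rewrite sumEFin; congr EFin; rewrite {1}[u]row_sum_delta.
  rewrite [in LHS]/dot.
  under eq_bigr do rewrite summxE mulr_suml.
  rewrite exchange_big; apply: eq_bigr => i _; rewrite /dot mulr_sumr.
  by apply: eq_bigr => j _; rewrite mxE mulrA.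
under eq_integral do rewrite dotE.
rewrite (@integral_sum _ _ _ P B mB 'I_d
  (fun i t => (u 0 i)%:E * (dot (delta_mx 0 i) (X t))%:E)%E); last first.
  by move=> i; apply: integrableZl => //; exact: iB.
under eq_bigr => i _.
  rewrite integralZl//; last exact: iB.
  rewrite -/(m i) -(@fineK _ (m i)); last by apply: integrable_fin_num => //; exact: iB.
  rewrite -EFinM.
  over.
rewrite sumEFin; congr EFin; rewrite /dot mulr_sumr; apply: eq_bigr => i _.
by rewrite mxE; field.
Qed.

(* With [v = E[X | B]], the inequality [1 + y <= exp y] gives
   [P B = E[1 + u . (X - v); B] <= E exp (u . (X - v))]. *)
Lemma conditional_mean_finite_rate P B (r : R) v :
  measurable B -> (0 < P B)%E -> (forall t, B t -> `|X t : 'rV[R]_d| <= r) ->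
  (forall u,
    (\int[P]_(t in B) (dot u (X t))%:E)%E = (fine (P B) * dot u v)%:E) ->
  finite_rate P v.
Proof.
move=> mB PB Br hv; have fB := fineK (fin_num_measure P B mB).
exists (fine (P B)); first by rewrite -lte_fin fB.
move=> u; set e := expR (dot u v).
have iB : P.-integrable B (EFin \o (fun t => dot u (X t))).
  exact: bounded_dot_integrable mB Br.
have mexp := expdot_measurable u.
have iexp : P.-integrable B (EFin \o (fun t => expR (dot u (X t)))).
  apply: measurable_bounded_integrable => //.
  - by rewrite (le_lt_trans (probability_le1 P mB)) ?ltry.
  - by apply: measurable_funTS; apply/measurable_EFinP.
  - exists (expR ((\sum_i `|u 0 i|) * r)); split; first exact: num_real.
    move=> s hs t Bt; apply: le_trans (ltW hs).
    rewrite ger0_norm ?expR_ge0// ler_expR.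
    by apply: le_trans (ler_norm _) _; apply: bounded_dot; exact: Br.
have ic (s : R) : P.-integrable B (EFin \o cst s).
  exact: finite_measure_integrable_cst.
have iZ : P.-integrable B (fun t => e%:E * (dot u (X t))%:E)%E.
  exact: integrableZl.
have -> : (fine (P B) * e)%:E = (\int[P]_(t in B)
    ((e * (1 - dot u v))%:E + e%:E * (dot u (X t))%:E))%E.
  rewrite (integralD mB (ic (e * (1 - dot u v))) iZ).
  rewrite [X in (X + _)%E](@integral_cst _ _ _ P B mB (e * (1 - dot u v))%:E).
  rewrite integralZl// hv.
  transitivity ((e * (1 - dot u v))%:E * (fine (P B))%:E +
    e%:E * (fine (P B) * dot u v)%:E)%E; last by rewrite fB.
  by rewrite -!EFinM -EFinD; congr EFin; ring.
apply: le_trans (_ : \int[P]_(t in B) (expR (dot u (X t)))%:E <= _)%E.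
  apply: le_integral => //; first exact: (integrableD mB (ic (e * (1 - dot u v))) iZ).
  move=> t _; rewrite -EFinM -EFinD lee_fin -mulrDr.
  have -> : expR (dot u (X t)) = e * expR (dot u (X t) - dot u v).
    by rewrite -expRD addrC subrK.
  by rewrite ler_pM2l ?expR_gt0//; apply: le_trans (expR_ge1Dx _); lra.
by apply: ge0_subset_integral => // t _; rewrite lee_fin expR_ge0.
Qed.

End rate.

(** * Finite rate on the relative interior of the hull *)

Section rate_interior.
Context {disp : measure_display} {T : measurableType disp} {R : realType}
  {d : nat} (X : {mfun T >-> borel_rV R d}).
Implicit Types (P : probability T R) (S U : set 'rV[R]_d) (x u v a : 'rV[R]_d).

Lemma finite_rate_near P x a (b : R) : supp P X x -> b < dot a x ->
  exists2 v, finite_rate X P v & b < dot a v.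
Proof.
(* The mean over [U] only inherits the weak inequality [b' <= dot a v], so a level strictly between
   [b] and [dot a x] is used. *)
move=> sx bx; pose b' := (b + dot a x) / 2.
pose U := ball x 1 `&` [set y | b' < dot a y].
have oU : open U.
  apply: openI; first exact: ball_open.
  apply: (@open_comp _ _ (dot a) [set r | b' < r]); last exact: open_gt.
  by move=> y _; exact: dot_continuous.
have Ux : U x by split; [exact: ballxx|rewrite /= /b'; lra].
have mB := open_preimage X oU.
have PB := supp_open_gt0 sx oU Ux.
have Br t : (X @^-1` U) t -> `|X t : 'rV[R]_d| <= `|x| + 1.
  move=> [xX _]; rewrite -[X in `|X|](subrK x) addrC.
  apply: le_trans (ler_normD _ _) _; rewrite lerD2l ltW//.
  by rewrite distrC; move: xX; rewrite mx_norm_ball.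
have [v hv] := conditional_mean mB PB Br.
exists v; first exact: conditional_mean_finite_rate mB PB Br hv.
have fB := fineK (fin_num_measure P _ mB).
have PB0 : 0 < fine (P (X @^-1` U)) by rewrite -lte_fin fB.
suff : b' <= dot a v by rewrite /b'; lra.
rewrite -(ler_pM2l PB0) -lee_fin -hv mulrC EFinM.
have ic : P.-integrable (X @^-1` U) (EFin \o cst b').
  exact: finite_measure_integrable_cst.
have := @integral_cst _ _ _ P _ mB b'%:E; rewrite -[X in (_ * X)%E]fB => <-.
apply: le_integral => //; first exact: bounded_dot_integrable mB Br.
by move=> t /[!inE] -[_ /ltW]; rewrite lee_fin.
Qed.

Lemma rint_finite_rate P : rint (convsupp P X) `<=` finite_rate X P.
Proof.
move=> v rv; apply: contrapT => nv.
have [x sx] := supp_neq0 X P.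
have D0 : finite_rate X P !=set0.
  (* The zero normal with offset [-1] makes the half-space condition void; only existence is
     wanted. *)
  have [|w Dw _] := @finite_rate_near P x 0 (-1) sx; last by exists w.
  by rewrite dot0l; lra.
have [a [ale [y Dy ay]]] := proper_separation (@finite_rate_convex _ _ _ _ X P)
  D0 (fun h => nv (rint_sub h)).
have sle : convsupp P X `<=` [set z | dot a z <= dot a v].
  apply: convex_hull_min.
    move=> p q t /= hp hq t0 t1; rewrite dotDr !dotZr.
    have : 0 <= (1 - t) * (dot a v - dot a p) by apply: mulr_ge0; lra.
    have : 0 <= t * (dot a v - dot a q) by apply: mulr_ge0; lra.
    by lra.
  move=> z sz /=; rewrite leNgt; apply/negP => /(finite_rate_near sz)[w /ale].
  by lra.
(* [y] lies strictly below the level of [v], so it is enough that [X], and with it every point of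
   finite rate, is confined to this level. *)
suff : hyperplane a (dot a v) y by rewrite /hyperplane /=; lra.
apply: finite_rate_hyperplane Dy.
apply: probability1_sub (convsupp_full X P).
- exact: convsupp_preimage.
- by apply: closed_preimage; exact: hyperplane_closed.
(* The form [dot a] is maximal over the hull at the relative interior point [v], hence constant on
   the hull. *)
move=> t /= Ct; have [z [s [Cz s0 s1 vE]]] := rint_prolong rv (affine_hull_sub Ct).
have /= h1 := sle _ Ct; have /= h2 := sle _ Cz.
have E : dot a v = (1 - s) * dot a (X t) + s * dot a z.
  by rewrite {1}vE dotDr !dotZr.
have h3 : 0 <= s * (dot a v - dot a z) by apply: mulr_ge0; lra.
have h4 : (1 - s) * (dot a v - dot a (X t)) <= 0 by lra.
apply/eqP; rewrite eq_le h1 /= -subr_le0.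
by move: h4; rewrite pmulr_rle0// subr_gt0.
Qed.

End rate_interior.

(** * Lower bounds on a supporting hyperplane *)

Section rate_face.
Context {disp : measure_display} {T : measurableType disp} {R : realType}
  {d : nat} (X : {mfun T >-> borel_rV R d}).
Implicit Types (P : probability T R) (S U : set 'rV[R]_d) (x u v a : 'rV[R]_d).

Lemma mgf_convex P u0 u1 (t : R) : 0 <= t -> t <= 1 ->
  (mgf X P ((1 - t) *: u0 + t *: u1) <=
   (1 - t)%:E * mgf X P u0 + t%:E * mgf X P u1)%E.
Proof.
move=> t0 t1; have t1' : 0 <= 1 - t by rewrite subr_ge0.
have ge u : forall s : T, setT s -> (0 <= (expR (dot u (X s)))%:E)%E.
  by move=> s _; rewrite lee_fin expR_ge0.
rewrite -!ge0_integralZl ?lee_fin//; do ?exact: ge; do ?exact: expdot_measurable.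
rewrite -ge0_integralD//.
- apply: ge0_le_integral => //; first exact: expdot_measurable.
    by apply: emeasurable_funD; apply: measurable_funeM; exact: expdot_measurable.
  move=> s _; rewrite -!EFinM -EFinD lee_fin dotDl !dotZl.
  have t1'' : 1 - t <= 1 by lra.
  have := convex_expR (Itv01 t1' t1'') (dot u0 (X s)) (dot u1 (X s)).
  by rewrite !convRE /= /unstable.onem subKr.
- by move=> s _; rewrite mule_ge0 ?lee_fin ?expR_ge0.
- by apply: measurable_funeM; exact: expdot_measurable.
- by move=> s _; rewrite mule_ge0 ?lee_fin ?expR_ge0.
- by apply: measurable_funeM; exact: expdot_measurable.
Qed.

Lemma mgf_domain_convex P : convex [set u | (mgf X P u < +oo)%E].
Proof.
move=> u0 u1 t /= h0 h1 t0 t1; apply: le_lt_trans (mgf_convex _ _ _ t0 t1) _.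
rewrite -(fineK (_ : mgf X P u0 \is a fin_num)) ?ge0_fin_numE ?mgf_ge0//.
rewrite -(fineK (_ : mgf X P u1 \is a fin_num)) ?ge0_fin_numE ?mgf_ge0//.
by rewrite -!EFinM -EFinD ltry.
Qed.

(* Replacing [u] by [u + n a] leaves the lower bound at [v] unchanged up to the
   common factor [exp (n b)], and concentrates the integral on the face. *)
Lemma finite_rate_face_bound P a (b c : R) v u :
  convsupp P X `<=` [set x | dot a x <= b] -> hyperplane a b v -> 0 < c ->
  (forall u, ((c * expR (dot u v))%:E <= mgf X P u)%E) ->
  (mgf X P u < +oo)%E ->
  ((c * expR (dot u v))%:E <=
   \int[P]_(t in X @^-1` hyperplane a b) (expR (dot u (X t)))%:E)%E.
Proof.
move=> Cb vb c0 hc mu; rewrite /hyperplane /= in vb.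
pose H := X @^-1` [set x | dot a x <= b].
have mH : measurable H by apply: closed_preimage; exact: halfspace_closed.
have PH : P H = 1%E.
  apply: probability1_sub (convsupp_full X P) => //; first exact: convsupp_preimage.
  by move=> t /= /Cb.
have mL : measurable (X @^-1` hyperplane a b).
  by apply: closed_preimage; exact: hyperplane_closed.
(* [f n] is the integrand of the generating function at [u + n a], divided by [exp (n b)]. *)
pose f n t := (expR (dot u (X t)) * expR (dot a (X t) - b) ^+ n)%:E.
pose g t := (expR (dot u (X t)))%:E.
have mf n : measurable_fun setT (f n).
  have -> : f n = fun t => ((expR (- (n%:R * b)))%:E *
      (expR (dot (u + n%:R *: a) (X t)))%:E)%E.
    apply/funext => t; rewrite /f -expRM_natl -expRD -EFinM -expRD.
    by congr (expR _)%:E; rewrite dotDl dotZl; ring.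
  by apply: measurable_funeM; exact: expdot_measurable.
have bound n : ((c * expR (dot u v))%:E <= \int[P]_(t in H) f n t)%E.
  rewrite -(integral_prob1 mH PH (mf n)); last first.
    by move=> t; rewrite lee_fin mulr_ge0 ?exprn_ge0 ?expR_ge0.
  have -> : (\int[P]_t f n t =
      (expR (- (n%:R * b)))%:E * mgf X P (u + n%:R *: a))%E.
    rewrite /mgf -ge0_integralZl ?lee_fin ?expR_ge0//; last first.
      exact: expdot_measurable.
    apply: eq_integral => t _; rewrite /f -expRM_natl -expRD -EFinM -expRD.
    by congr (expR _)%:E; rewrite dotDl dotZl; ring.
  have -> : (c * expR (dot u v))%:E =
     ((expR (- (n%:R * b)))%:E * (c * expR (dot (u + n%:R *: a) v))%:E)%E.
    rewrite -EFinM mulrCA -expRD; congr (_ * expR _)%:E.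
    by rewrite dotDl dotZl vb; ring.
  by apply: lee_pmul => //; rewrite lee_fin ?mulr_ge0 ?expR_ge0 ?ltW.
have ig : P.-integrable H g.
  apply: (@integrableS _ _ _ P setT) => //.
  apply/integrableP; split; first exact: expdot_measurable.
  under eq_integral do rewrite gee0_abs ?lee_fin ?expR_ge0//.
  exact: mu.
(* On [H] the powered factor is at most 1, with equality only on the hyperplane; hence [g]
   dominates, and the limit is [g] restricted to the hyperplane. *)
have cvg : (\int[P]_(t in H) f n t @[n --> \oo] -->
    \int[P]_(t in H) (g \_ (X @^-1` hyperplane a b)) t)%E.
  apply: (@dominated_cvg _ _ _ P H mH f _ g) => //.
  - by move=> n; exact: measurable_funTS.
  - move=> t Ht; rewrite patchE; case: ifPn => [|].
      rewrite inE /= /hyperplane /= => Et.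
      rewrite /f Et subrr expR0; under eq_fun do rewrite expr1n mulr1.
      exact: cvg_cst.
    rewrite notin_setE /= /hyperplane /= => Et.
    have lt : dot a (X t) - b < 0.
      by rewrite subr_lt0 lt_neqAle; apply/andP; split; [exact/eqP|exact: Ht].
    apply: cvg_EFin; first by apply: nearW => n.
    rewrite -(mulr0 (expR (dot u (X t)))); apply: cvgMl_tmp.
    by apply: cvg_expr; rewrite ger0_norm ?expR_ge0// expR_lt1.
  - move=> n t Ht; rewrite gee0_abs ?lee_fin ?mulr_ge0 ?exprn_ge0 ?expR_ge0//.
    rewrite ger_pMr ?expR_gt0// exprn_ile1 ?expR_ge0// -expR0 ler_expR.
    by rewrite subr_le0.
have := lime_ge (cvgP _ cvg) (nearW _ bound); rewrite (cvg_lim _ cvg)//.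
rewrite -integral_mkcondr setIidr; first exact.
by move=> t; rewrite /hyperplane /H /= => ->.
Qed.

End rate_face.

(** * Faces and the projection property *)

Section rate_conditioned.
Context {disp : measure_display} {T : measurableType disp} {R : realType}
  {d : nat} (X : {mfun T >-> borel_rV R d}).
Implicit Types (P Q : probability T R) (A C : set 'rV[R]_d) (x u v a : 'rV[R]_d).

Lemma mgf_given P A u : measurable (X @^-1` A) -> (0 < P (X @^-1` A))%E ->
  mgf X (given P X A) u = (((fine (P (X @^-1` A)))^-1)%:E *
    \int[P]_(t in X @^-1` A) (expR (dot u (X t)))%:E)%E.
Proof.
move=> mA PA; apply: integral_cond_prob => //; exact: expdot_measurable.
Qed.

Lemma mgf0 P : mgf X P 0 = 1%E.
Proof.
rewrite /mgf (eq_integral (cst 1%E)); last by move=> t _; rewrite dot0l expR0.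
by rewrite integral_cst// mul1e; exact: probability_setT.
Qed.

Lemma finite_rate_given P A : measurable (X @^-1` A) -> (0 < P (X @^-1` A))%E ->
  finite_rate X (given P X A) `<=` finite_rate X P.
Proof.
move=> mA PA v [c c0 hc]; set p := fine (P (X @^-1` A)).
have p0 : 0 < p by rewrite -lte_fin (fineK (fin_num_measure P _ mA)).
exists (p * c); first exact: mulr_gt0.
move=> u; have := hc u; rewrite mgf_given// -/p => h.
apply: (@le_trans _ _ (\int[P]_(t in X @^-1` A) (expR (dot u (X t)))%:E)%E).
  by rewrite -mulrA EFinM -lee_pdivlMl.
apply: ge0_subset_integral => //; exact: expdot_measurable.
Qed.

Lemma mgf_given_setI1 P A C u : measurable (X @^-1` A) ->
  measurable (X @^-1` C) -> P (X @^-1` C) = 1%E -> (0 < P (X @^-1` A))%E ->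
  mgf X (given P X (C `&` A)) u = mgf X (given P X A) u.
Proof.
move=> mA mC PC PA; apply: eq_measure_integral => B mB _.
have E : P (X @^-1` (C `&` A)) = P (X @^-1` A).
  by rewrite preimage_setI setIC probability_setI1.
have mCA : measurable (X @^-1` (C `&` A)).
  by rewrite preimage_setI; exact: measurableI.
rewrite [LHS]cond_probE//; last by rewrite E.
rewrite [RHS]cond_probE// E preimage_setI (setIC (X @^-1` C)) setIA.
by rewrite probability_setI1//; exact: measurableI.
Qed.

(** Move from [u] in the domain towards a relative interior point [u0]: convexity bounds the
    generating function from above, [1 + y <= exp y] bounds the left side from below, and the weight
    of [u0] tends to 0. Outside the domain the right side is infinite. *)
Lemma finite_rate_closure P (c : R) v : 0 <= c ->
  (forall u, rint (effective_domain (cumulant P X)) u ->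
    ((c * expR (dot u v))%:E <= mgf X P u)%E) ->
  forall u, ((c * expR (dot u v))%:E <= mgf X P u)%E.
Proof.
move=> c0 hc u; rewrite cumulant_domainE in hc.
have [mu|] := ltP (mgf X P u) +oo%E; last first.
  by rewrite leye_eq => /eqP ->; rewrite leey.
have [|u0 ru0] := rint_exists (@mgf_domain_convex _ _ _ _ X P).
  by exists 0; rewrite /= mgf0 ltry.
have mu0 := rint_sub ru0; rewrite /= in mu0.
have fu : mgf X P u \is a fin_num by rewrite ge0_fin_numE// mgf_ge0.
have fu0 : mgf X P u0 \is a fin_num by rewrite ge0_fin_numE// mgf_ge0.
rewrite -(fineK fu) lee_fin.
set A := c * expR (dot u v).
set r := fine (mgf X P u); set r0 := fine (mgf X P u0).
set k := dot u0 v - dot u v.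
have A0 : 0 <= A by rewrite mulr_ge0// expR_ge0.
have H (t : R) : 0 < t -> t <= 1 -> A * (1 + t * k) <= (1 - t) * r + t * r0.
  move=> t0 t1; rewrite -lee_fin.
  apply: (@le_trans _ _ (mgf X P ((1 - t) *: u + t *: u0))).
    have rt := rint_segment (@mgf_domain_convex _ _ _ _ X P) mu ru0 t0 t1.
    apply: le_trans (hc _ rt).
    have -> : dot ((1 - t) *: u + t *: u0) v = dot u v + t * k.
      by rewrite dotDl !dotZl /k; ring.
    rewrite lee_fin expRD mulrA -/A ler_wpM2l//; exact: expR_ge1Dx.
  apply: le_trans (mgf_convex X P u u0 (ltW t0) t1) _.
  by rewrite -(fineK fu) -(fineK fu0) -!EFinM -EFinD lexx.
(* After cancelling [A t k], [H] reads [A <= r + t m]; [t] is taken small enough that [t m <= e]. *)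
apply/ler_addgt0Pr => e e0; pose m := r0 - r - A * k.
pose t := Num.min 1 (e / (`|m| + 1)).
have m1 : 0 < `|m| + 1 by rewrite ltr_wpDl.
have t0 : 0 < t by rewrite lt_min ltr01 divr_gt0.
have t1 : t <= 1 by rewrite ge_min lexx.
have tm : t * m <= e.
  apply: (@le_trans _ _ (t * (`|m| + 1))).
    by rewrite ler_pM2l// (le_trans (ler_norm m))// lerDl.
  by rewrite -ler_pdivlMr// ge_min lexx orbT.
have := H t t0 t1.
have -> : (1 - t) * r + t * r0 = r + t * m + A * (t * k) by rewrite /m; ring.
by rewrite mulrDr mulr1; lra.
Qed.

(** The non-recursive clause of the projection property, isolated for a single distribution. *)
Definition hyperplane_projection P := forall a (b : R), a != 0 ->
  supports a b (convsupp P X) -> (0 < P (X @^-1` hyperplane a b) < 1)%E ->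
  hyperplane_proj a b @` rint (effective_domain (cumulant P X)) =
  hyperplane_proj a b @`
    rint (effective_domain (cumulant (given P X (hyperplane a b)) X)).

(** Equality of projections writes each [u] in the relative interior of the conditional domain as
    [u' + s a] with [u'] in the unconditional one. As [X] on [L] and [v] both have product [b] with
    [a], this shift multiplies both sides of the bound by [exp (s b)]. *)
Lemma finite_rate_hyperplane_given P a (b : R) v : hyperplane_projection P ->
  a != 0 -> convsupp P X `<=` [set x | dot a x <= b] ->
  (exists2 x, convsupp P X x & dot a x < b) ->
  finite_rate X P v -> hyperplane a b v ->
  (0 < P (X @^-1` hyperplane a b))%E /\
  finite_rate X (given P X (hyperplane a b)) v.
Proof.
move=> proj a0 Cb [x Cx xb] [c c0 hc] vb.
set L := hyperplane a b in vb *.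
have mL : measurable (X @^-1` L).
  by apply: closed_preimage; exact: hyperplane_closed.
have fL := fineK (fin_num_measure P _ mL).
have bound := finite_rate_face_bound Cb vb c0 hc.
(* At [u = 0] the bound says that [c] is at most the probability of [L]. *)
have PL : (0 < P (X @^-1` L))%E.
  apply: lt_le_trans (_ : (c * expR (dot 0 v))%:E <= _)%E.
    by rewrite lte_fin mulr_gt0// expR_gt0.
  apply: le_trans (bound 0 _) _; first by rewrite mgf0 ltry.
  rewrite (eq_integral (cst 1%E)); last by move=> t _; rewrite dot0l expR0.
  by rewrite integral_cst// mul1e.
split=> //.
(* The point [x] of the hull off [L] excludes full probability. *)
have PL1 : (P (X @^-1` L) < 1)%E.
  rewrite lt_neqAle probability_le1// andbT; apply/eqP => PL1.
  have := convsupp_min (@hyperplane_closed R d a b)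
    (@hyperplane_convex R d a b) PL1 Cx.
  by rewrite /hyperplane /=; lra.
have sup : supports a b (convsupp P X).
  split; last by left.
  apply/set0P/eqP => LC0; move: PL.
  rewrite -(probability_setI1 (convsupp_preimage X P) mL (convsupp_full X P)).
  by rewrite -preimage_setI LC0 preimage_set0 measure0 ltxx.
have := proj a b a0 sup; rewrite PL PL1 => /(_ isT) projE.
set p := fine (P (X @^-1` L)).
have p0 : 0 < p by rewrite -lte_fin fL.
exists (c / p); first exact: divr_gt0.
apply: finite_rate_closure => [|u ru]; first by rewrite divr_ge0// ltW.
have [u' ru' uu'] : (hyperplane_proj a b @` rint (effective_domain (cumulant P X)))
    (hyperplane_proj a b u) by rewrite projE; exists u.
have mu' : (mgf X P u' < +oo)%E.
  by have := rint_sub ru'; rewrite cumulant_domainE.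
have [s uE] : exists s, u = u' + s *: a.
  exists ((b - dot a u') / dot a a - (b - dot a u) / dot a a).
  by rewrite scalerBl addrA; rewrite [u' + _]uu' addrK.
rewrite mgf_given// -/p mulrAC mulrC EFinM lee_pmul2l//; last first.
  by rewrite lte_fin invr_gt0.
have -> : (\int[P]_(t in X @^-1` L) (expR (dot u (X t)))%:E =
   (expR (s * b))%:E * \int[P]_(t in X @^-1` L) (expR (dot u' (X t)))%:E)%E.
  rewrite -ge0_integralZl ?lee_fin ?expR_ge0//; last first.
    by apply: measurable_funTS; exact: expdot_measurable.
  apply: eq_integral => t; rewrite inE /L /hyperplane /= => Lt.
  by rewrite uE dotDl dotZl Lt addrC expRD EFinM.
have -> : c * expR (dot u v) = expR (s * b) * (c * expR (dot u' v)).
  rewrite uE dotDl dotZl; rewrite /L /hyperplane /= in vb.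
  by rewrite vb addrC expRD; ring.
by rewrite EFinM lee_pmul2l ?lte_fin ?expR_gt0//; exact: bound.
Qed.

(** The separating hyperplane may cut out a face that is not maximal. Conditioning on it serves to
    locate [v] on the hyperplane exposing a maximal face, to which the previous lemma is applied
    afresh. *)
Lemma finite_rate_boundary P v : hyperplane_projection P ->
  finite_rate X P v -> ~ rint (convsupp P X) v ->
  exists2 C, charged_maximal_faces P X C & finite_rate X (given P X C) v.
Proof.
move=> proj Dv nv; set K := convsupp P X.
have cK : convex K by exact: convsupp_convex.
have mK := convsupp_preimage X P; have PK := convsupp_full X P.
have [a [ale [x Kx ax]]] := proper_separation cK (convsupp_neq0 X P) nv.
set b := dot a v in ale ax.
have a0 : a != 0 by apply: contraTneq ax => a0; rewrite /b a0 !dot0l ltxx.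
have [PL DLv] := finite_rate_hyperplane_given proj a0 ale
  (ex_intro2 _ _ x Kx ax) Dv (erefl : hyperplane a b v).
set L := hyperplane a b in PL DLv.
have mL : measurable (X @^-1` L).
  by apply: closed_preimage; exact: hyperplane_closed.
have KL0 : (K `&` L) !=set0.
  apply/set0P/eqP => LC0; move: PL.
  rewrite -(probability_setI1 mK mL PK).
  by rewrite -preimage_setI setIC LC0 preimage_set0 measure0 ltxx.
have KLK : K `&` L <> K.
  by move=> E; move: Kx; rewrite -E => -[_]; rewrite /L /hyperplane /=; lra.
have [C [mC KLC]] := maximal_face_above (conj (hyperplane_face cK ale) KL0) KLK.
have [a1 [b1 [a10 Kb1 CE]]] := maximal_face_exposed cK mC.
set L1 := hyperplane a1 b1 in CE.
have mL1 : measurable (X @^-1` L1).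
  by apply: closed_preimage; exact: hyperplane_closed.
(* Given [L], the vector lives on [K] and [L] together, hence in [C] and so on [L1]; points of
   finite rate follow it there. *)
have vL1 : L1 v.
  apply: finite_rate_hyperplane DLv.
  have Q1 := cond_prob_self mL PL.
  apply: probability1_sub (_ : given P X L (X @^-1` K `&` X @^-1` L) = 1%E) => //.
  - exact: measurableI.
  - by rewrite -preimage_setI => t /KLC; rewrite CE => -[].
  - rewrite -Q1 probability_setI1//.
    by rewrite Q1; exact: cond_prob1.
have [y Ky y1] : exists2 y, K y & dot a1 y < b1.
  apply: contrapT => H; case: mC => _ + _; apply.
  rewrite CE; apply/setIidPl => y Ky; rewrite /L1 /hyperplane /=.
  apply/eqP; rewrite eq_le (Kb1 y Ky) /= leNgt; apply/negP => y1.
  by apply: H; exists y.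
have [PL1 [c c0 hc]] := finite_rate_hyperplane_given proj a10 Kb1
  (ex_intro2 _ _ y Ky y1) Dv vL1.
(* [K] has full probability, so conditioning on [C], the part of [L1] in [K], gives the same
   generating function as conditioning on [L1]. *)
exists C.
  split=> //; rewrite CE preimage_setI setIC probability_setI1//.
exists c => // u; rewrite CE mgf_given_setI1//; exact: hc.
Qed.

(** The length bound is a parameter [n] so that the induction can use the dimension of the hull.
    Indices start at 1; the value at 0 is arbitrary. *)
Definition rint_chain P n v := exists (k : nat) (C : nat -> set 'rV[R]_d),
  [/\ (1 <= k <= n)%N,
      charged_maximal_faces P X (C 1%N),
      forall i : nat, (1 <= i < k)%N ->
        charged_maximal_faces (given P X (C i)) X (C i.+1) &
      rint (convsupp (given P X (C k)) X) v].

Section chain.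
Variables (P : probability T R) (k : nat) (C : nat -> set 'rV[R]_d).
Hypothesis C1 : charged_maximal_faces P X (C 1%N).
Hypothesis Ci : forall i : nat, (1 <= i < k)%N ->
  charged_maximal_faces (given P X (C i)) X (C i.+1).

Lemma chain_preimage i : (1 <= i <= k)%N -> measurable (X @^-1` C i).
Proof.
case: i => [//|[_|i ik]]; first exact: charged_face_preimage C1.
exact: charged_face_preimage (@Ci i.+1 ik).
Qed.

Lemma chain_gt0 i : (1 <= i <= k)%N -> (0 < P (X @^-1` C i))%E.
Proof.
case: i => [//|[_|i ik]]; first by case: C1.
have [_] := @Ci i.+1 ik; apply: cond_prob_gt0; first exact: chain_preimage.
by apply: chain_preimage; rewrite /= ltnW.
Qed.

Lemma chain_sub i : (1 <= i <= k)%N -> C i `<=` convsupp P X.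
Proof.
case: i => [//|[_|i ik]]; first by case: C1 => -[[[]]].
have [[[[+ _ _]]]] := @Ci i.+1 ik.
move=> /subset_trans h _ _ _ _; apply: h; apply: convsupp_given.
by apply: chain_preimage; rewrite /= ltnW.
Qed.

End chain.

(** Conditioning successively along a chain amounts to conditioning on its last set, which lets a
    chain for [X] given [C1] be read as one for [X]. *)
Lemma given_given P A C : A `<=` C -> measurable (X @^-1` A) ->
  measurable (X @^-1` C) -> (0 < P (X @^-1` A))%E ->
  given (given P X C) X A = given P X A.
Proof. by move=> AC; apply: cond_prob_cond => t /AC. Qed.

Lemma finite_rate_chain n P v : projection_property X P ->
  has_dim (convsupp P X) n -> finite_rate X P v ->
  rint (convsupp P X) v \/ rint_chain P n v.
Proof.
elim/ltn_ind: n P => n IH P [proj1 proj2] dn Dv.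
have [rv|nv] := pselect (rint (convsupp P X) v); [by left|right].
have [C1 cC1 D1v] := finite_rate_boundary proj1 Dv nv.
have mC1 := charged_face_preimage cC1.
have [m dm] := has_dim_exists (convsupp_neq0 X (given P X C1)).
have [[[fC1 C10] C1K _] PC1] := cC1.
have [m1 dm1] := has_dim_exists C10.
have sC1 := convsupp_charged_face cC1.
(* The new hull lies in [C1], a proper face, so its dimension drops and the induction applies. *)
have mn : (m < n)%N.
  exact: leq_ltn_trans (has_dim_le dm dm1 sC1) (face_dim fC1 C10 C1K dn dm1).
case: (IH m mn _ (proj2 _ cC1) dm D1v) => [rv|[k [C [/andP[k1 km] hC1 hCi rv]]]].
  exists 1%N, (fun=> C1); split=> //; first by rewrite (leq_ltn_trans _ mn).
  by move=> i; case: i => [|i]; rewrite ?andbF// ltnS ltn0 andbF.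
have gE i : (1 <= i <= k)%N -> given (given P X C1) X (C i) = given P X (C i).
  move=> ik; have mCi := chain_preimage hC1 hCi ik.
  apply: given_given => //.
    exact: subset_trans (chain_sub hC1 hCi ik) sC1.
  exact: cond_prob_gt0 mCi mC1 (chain_gt0 hC1 hCi ik).
(* Shift the chain by one and put [C1] in front; index 0 receives [C1] as a filler. *)
exists k.+1, (fun i => if i is j.+2 then C j.+1 else C1); split=> //.
- by rewrite /= (leq_ltn_trans km mn).
- move=> [//|[_|i]] //=; rewrite ltnS => ik.
  by rewrite -gE; [exact: hCi|rewrite /= ltnW].
- by case: k k1 km hCi rv gE => [//|k] _ _ _ rv gE; rewrite -gE// ltnS leqnn.
Qed.

End rate_conditioned.

(** * The domain of the rate function *)

Theorem corollary2 (R : realType) (d : nat) (disp : measure_display)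
    (T : measurableType disp) (P : probability T R)
    (X : {mfun T >-> borel_rV R d}) :
  (1 <= d)%N ->
  projection_property X P ->
  effective_domain (rate_function P X) `<=` convsupp P X /\
  effective_domain (rate_function P X) =
    rint (convsupp P X) `|`
    [set v | exists (k : nat) (C : nat -> set 'rV[R]_d),
      [/\ (1 <= k <= d)%N,
          charged_maximal_faces P X (C 1%N),
          forall i : nat, (1 <= i < k)%N ->
            charged_maximal_faces (given P X (C i)) X (C i.+1) &
          rint (convsupp (given P X (C k)) X) v]].
Proof.
move=> _ proj; rewrite finite_rateE.
suff E : finite_rate X P = rint (convsupp P X) `|` [set v | rint_chain X P d v].
  (* The inclusion follows from the equality, since conditioning only shrinks the hull of the
     support. *)
  split=> //; rewrite E => v [/rint_sub//|[k [C [/andP[k1 _] hC1 hCi]]]].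
  move=> /rint_sub; apply: convsupp_given.
  by apply: (chain_preimage hC1 hCi); rewrite k1 leqnn.
apply/seteqP; split=> v.
  have [n dn] := has_dim_exists (convsupp_neq0 X P).
  move=> /(finite_rate_chain proj dn)[rv|[k [C [/andP[k1 kn] ? ? ?]]]]; [by left|right].
  (* Chains are no longer than the dimension of the hull, which is at most [d]. *)
  exists k, C; split=> //; rewrite k1/=; exact: leq_trans kn (has_dim_leq dn).
move=> [/rint_finite_rate//|[k [C [/andP[k1 _] hC1 hCi]]]].
have kk : (1 <= k <= k)%N by rewrite k1 leqnn.
move=> /rint_finite_rate.
have mCk := chain_preimage hC1 hCi kk.
exact: finite_rate_given mCk (chain_gt0 hC1 hCi kk) _.
Qed.
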